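(* Let $U = n^{1+\alpha}$ for a constant $\alpha>0$ and word size $w = \log U$. For sufficiently large $n$ and any positive integer $k \le \log^* n$, if a dynamic dictionary (maintaining at most $n$ keys from $[U]$) incurs $r \le \log^{(k)} n$ wasted bits per key, then it must perform $\Omega(nk)$ cell-probes in expectation to process a random operation sequence sampled from the hard distribution below; i.e., the expected amortized time per operation is $\Omega(k)$.
   Context: A dynamic dictionary maintains a set of at most $n$ distinct keys from $[U]$ under insertions, deletions and membership queries, in the cell-probe model: memory consists of cells of $w$ bits, each read/write of a cell costs one unit, computation is free. The memory has $\log\binom{U}{n}+R$ bits; $r=R/n$ is the number of wasted bits per key. Hard distribution: initialize an empty dictionary with capacity $n$ over $[U]$; pick $K$, a uniformly random $n$-element subset of $[U]$, and insert its keys one by one; then for $i=1,\dots,n$ perform a meta-operation: let $d_i$ be a uniformly random key of $K$ not yet removed, query $d_i$, delete $d_i$, let $a_i$ be a uniformly random key of $[U]$ that is neither in $K$ nor in the current dictionary, and insert $a_i$. $\log^{(k)}$ is the $k$-fold iterated logarithm. *)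

(* Defs.v *)
From Stdlib Require Import Reals.
From mathcomp Require Import all_boot.
Unset Printing Implicit Defensive.

(* A program run by the data structure for one operation, in the cell-probe
   model: M memory cells, each holding a word in 'I_W (W = 2^w).  Computation
   is free; each cell read or cell write costs one probe.  Being an inductive
   tree, every program terminates. *)
Inductive prog (M W : nat) : Type :=
| Ret : bool -> prog M W
| Read : 'I_M -> ('I_W -> prog M W) -> prog M W
| Write : 'I_M -> 'I_W -> prog M W -> prog M W.

Arguments Ret {M W}.
Arguments Read {M W}.
Arguments Write {M W}.

Definition mem (M W : nat) := 'I_M -> 'I_W.

Fixpoint run {M W} (p : prog M W) (m : mem M W) : bool * mem M W * nat :=
  match p with
  | Ret b => (b, m, 0)
  | Read a k => let '(b, m', c) := run (k (m a)) m in (b, m', c.+1)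
  | Write a v p' =>
      let '(b, m', c) := run p' (fun j => if j == a then v else m j) in
      (b, m', c.+1)
  end.

Inductive op (U : nat) : Type :=
| Ins : 'I_U -> op U
| Del : 'I_U -> op U
| Qry : 'I_U -> op U.

Record dict (U w : nat) := Dict {
  cells : nat;
  init : mem cells (2 ^ w);
  alg : op U -> prog cells (2 ^ w)
}.
Arguments cells {U w}.
Arguments init {U w}.
Arguments alg {U w}.
Arguments Ins {U}.
Arguments Del {U}.
Arguments Qry {U}.

Section Dict.
Variables (U w : nat) (D : dict U w).
Local Notation M := (cells D).
Local Notation W := (2 ^ w).

Fixpoint correct_from (n : nat) (m : mem M W) (S : {set 'I_U}) (ops : seq (op U))
  : Prop :=
  match ops with
  | [::] => True
  | o :: ops' =>
      let '(b, m', _) := run (alg D o) m in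
      match o with
      | Ins x => (x \notin S) -> (#|S| < n) -> correct_from n m' (x |: S) ops'
      | Del x => (x \in S) -> correct_from n m' (S :\ x) ops'
      | Qry x => b = (x \in S) /\ correct_from n m' S ops'
      end
  end.

Definition correct_dict (n : nat) : Prop :=
  forall ops : seq (op U), correct_from n (init D) set0 ops.

(* uniform average of f over a finite set A (0 if A is empty) *)
Definition avg {T : finType} (A : {set T}) (f : T -> R) : R :=
  Rdiv (\big[Rplus/R0]_(x in A) f x) (INR #|A|).

Definition step (o : op U) (m : mem M W) : mem M W * nat :=
  let '(_, m', c) := run (alg D o) m in (m', c).

Fixpoint ins_all (m : mem M W) (s : seq 'I_U) : mem M W * nat :=
  match s with
  | [::] => (m, 0)
  | x :: s' => let '(m1, c1) := step (Ins x) m in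
               let '(m2, c2) := ins_all m1 s' in (m2, c1 + c2)
  end.

(* expected number of probes of the remaining i meta-operations, given the
   initial key set K, memory m, keys of K not yet removed Krem, and current
   content S of the dictionary. *)
Fixpoint meta (K : {set 'I_U}) (i : nat) (m : mem M W) (Krem S : {set 'I_U})
  : R :=
  match i with
  | 0 => R0
  | i'.+1 =>
      avg Krem (fun d =>
        let '(m1, c1) := step (Qry d) m in
        let '(m2, c2) := step (Del d) m1 in
        let S2 := S :\ d in
        avg (~: (K :|: S2)) (fun a =>
          let '(m3, c3) := step (Ins a) m2 in
          Rplus (INR (c1 + c2 + c3)) (meta K i' m3 (Krem :\ d) (a |: S2))))
  end.

(* Expected total number of cell-probes on the hard distribution with
   capacity n: K uniform among n-subsets of [U], its keys inserted one by one
   (in increasing order), then n meta-operations. *)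
Definition expected_probes (n : nat) : R :=
  avg [set K : {set 'I_U} | #|K| == n] (fun K =>
    let '(m1, c0) := ins_all (init D) (enum K) in
    Rplus (INR c0) (meta K n m1 K K)).

End Dict.
Arguments correct_dict {U w}.
Arguments expected_probes {U w}.

Definition log2 (x : R) : R := Rdiv (ln x) (ln 2).

Definition iter_log (k : nat) (x : R) : R := iter k log2 x.

(* log* x = least k such that log^{(k)} x <= 1 (fuel n is ample) *)
Fixpoint log_star_aux (fuel : nat) (x : R) : nat :=
  match fuel with
  | 0 => 0
  | f.+1 => if Rle_dec x R1 then 0 else (log_star_aux f (log2 x)).+1
  end.
Definition log_star (n : nat) : nat := log_star_aux n (INR n).

Definition univ (alpha : R) (n : nat) : nat :=
  Z.to_nat (Int_part (Rpower (INR n) (Rplus R1 alpha))).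
Definition wsize (alpha : R) (n : nat) : nat := up_log 2 (univ alpha n).

(* Main.v *)
Require Import Defs.
From Stdlib Require Import ZArith Reals Lra FunctionalExtensionality.
From mathcomp Require Import all_boot fingroup perm.
From mathcomp Require Import zify.
Set Implicit Arguments.
Unset Strict Implicit.

(** Cut the sequence of meta-operations into a tree of intervals and charge the
    probe of a cell to the level where the interval of its previous probe branches
    off; these charges telescope, so it suffices that each level receives Omega(n)
    of them.  Take a node with N meta-operations and B children, starting from the
    memory M0, and assume that cells are rarely touched by two of its children.
    Knowing M0 and the deleted keys, the final memory M1 determines the inserted
    keys, but as it wastes less than (N log B)/2 bits, it leaves their distribution
    among the children largely open: there are two runs with very different
    distributions and the same M1.  Colour the children with two colours so that
    the runs disagree on the colour of many inserted keys, and consider the cells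
    touched with the same colour in both runs.  Their contents in M1, like the
    deleted keys, are a function of M0 on the cells of one colour in the first run
    and of the other colour in the second run, and also of the complementary data.
    These two portions of the input being almost independent (the memory is almost
    full), these contents only depend on what the portions have in common, and then
    M1 and the remaining data store too many keys.
    With R wasted bits per key, the loss is smaller than (N log B)/2 as soon as
    log B is of order R n / N, whence a tower of about k levels. *)

(** * Cell-probe programs and lists of operations *)

Section Programs.
Context {M W : nat}.
Implicit Types (p : prog M W) (m : Defs.mem M W).

Definition ans p m : bool := (run p m).1.1.
Definition post p m : Defs.mem M W := (run p m).1.2.
Definition probes p m : nat := (run p m).2.

Fixpoint acc p m : {set 'I_M} :=
  match p with
  | Ret _ => set0
  | Read a k => a |: acc (k (m a)) m
  | Write a v p' => a |: acc p' (fun j => if j == a then v else m j)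
  end.

Lemma runE p m : run p m = (ans p m, post p m, probes p m).
Proof. by rewrite /ans /post /probes; case: (run p m) => [[]]. Qed.

Lemma post_notin p m c : c \notin acc p m -> post p m c = m c.
Proof.
elim: p m => [b|a k IH|a v p IH] m //=; rewrite /post /= in_setU1 negb_or.
  by case/andP=> _ /IH; rewrite runE.
by case/andP=> /negbTE nca /IH; rewrite runE /= nca.
Qed.

Lemma leq_acc_probes p m : #|acc p m| <= probes p m.
Proof.
elim: p m => [b|a k IH|a v p IH] m //=; first by rewrite cards0.
  by rewrite cardsU1 /probes /= runE /=; apply: leq_add (leq_b1 _) (IH _ _).
by rewrite cardsU1 /probes /= runE /=; apply: leq_add (leq_b1 _) (IH _).
Qed.

Lemma probes0 p m : probes p m = 0 -> post p m = m.
Proof. by case: p => [b|a k|a v p]; rewrite /probes /post //= runE. Qed.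

(** A program sees the memory only through the cells it probes. [C] may exceed the set of probed
    cells, so that agreement can be carried through successive programs. *)
Lemma run_local p m1 m2 (C : {set 'I_M}) :
  acc p m1 \subset C -> {in C, m1 =1 m2} ->
  [/\ ans p m2 = ans p m1, acc p m2 = acc p m1 &
      {in C, post p m1 =1 post p m2}].
Proof.
elim: p m1 m2 => [b|a k IH|a v p IH] m1 m2 //=; rewrite subUset sub1set.
  case/andP=> aC sC e12; have [] := IH _ _ _ sC e12.
  by rewrite /ans /post /= -(e12 a aC) !runE => -> -> ?; split.
case/andP=> aC sC e12.
have e12' : {in C, (fun j => if j == a then v else m1 j) =1
                   (fun j => if j == a then v else m2 j)}.
  by move=> c cC /=; case: ifP => // _; apply: e12.
by have [] := IH _ _ sC e12'; rewrite /ans /post /= !runE => -> -> ?; split.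
Qed.

End Programs.

Section Operations.
Context {U w : nat} (D : dict U w).
Local Notation M := (cells D).
Local Notation W := (2 ^ w).
Local Notation memory := (Defs.mem M W).
Implicit Types (m : memory) (o : op U) (s : seq (op U)) (S : {set 'I_U}).

Fixpoint runs s m : memory :=
  if s is o :: s' then runs s' (post (alg D o) m) else m.

Fixpoint accs s m : {set 'I_M} :=
  if s is o :: s' then acc (alg D o) m :|: accs s' (post (alg D o) m) else set0.

Fixpoint costs s m : nat :=
  if s is o :: s' then probes (alg D o) m + costs s' (post (alg D o) m) else 0.

Lemma runs_cat s1 s2 m : runs (s1 ++ s2) m = runs s2 (runs s1 m).
Proof. by elim: s1 m => //= o s1 IH m. Qed.

Lemma accs_cat s1 s2 m : accs (s1 ++ s2) m = accs s1 m :|: accs s2 (runs s1 m).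
Proof. by elim: s1 m => [|o s1 IH] m /=; rewrite ?set0U // IH setUA. Qed.

Lemma leq_accs_costs s m : #|accs s m| <= costs s m.
Proof.
elim: s m => [|o s IH] m /=; first by rewrite cards0.
rewrite cardsU; apply: leq_trans (leq_subr _ _) _.
exact: leq_add (leq_acc_probes _ _) (IH _).
Qed.

Lemma runs_notin s m c : c \notin accs s m -> runs s m c = m c.
Proof.
elim: s m => //= o s IH m; rewrite in_setU negb_or => /andP[no /IH ->].
exact: post_notin.
Qed.

Variable n : nat.

(** Quantifying over all continuations makes this a property of the memory alone: [m] represents
    [S], whatever operations produced it. *)
Definition ok m S := forall s, correct_from U w D n m S s.

Lemma ok_ans m S x : ok m S -> ans (alg D (Qry x)) m = (x \in S).
Proof. by move=> /(_ [:: Qry x]) /=; rewrite runE => -[]. Qed.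

Lemma ok_qry m S x : ok m S -> ok (post (alg D (Qry x)) m) S.
Proof. by move=> okm s; have /= := okm (Qry x :: s); rewrite runE => -[]. Qed.

Lemma ok_ins m S x : ok m S -> x \notin S -> #|S| < n ->
  ok (post (alg D (Ins x)) m) (x |: S).
Proof.
by move=> okm xS cS s; have /= := okm (Ins x :: s); rewrite runE; apply.
Qed.

Lemma ok_del m S x : ok m S -> x \in S -> ok (post (alg D (Del x)) m) (S :\ x).
Proof. by move=> okm xS s; have /= := okm (Del x :: s); rewrite runE; apply. Qed.

Lemma ok_inj m S S' : ok m S -> ok m S' -> S = S'.
Proof. by move=> o1 o2; apply/setP=> x; rewrite -(ok_ans x o1) (ok_ans x o2). Qed.

(** Without a probe the memory would not change and would have to answer the query for [x] both
    ways. *)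
Lemma ins_probes m S x : ok m S -> x \notin S -> #|S| < n ->
  0 < probes (alg D (Ins x)) m.
Proof.
move=> okm xS cS; rewrite lt0n; apply/eqP=> /probes0 e.
have := ok_ins okm xS cS; rewrite e => /(ok_ans x).
by rewrite (ok_ans x okm) setU11 (negbTE xS).
Qed.

Definition metaop (d a : 'I_U) := [:: Qry d; Del d; Ins a].

Lemma ok_metaop m S d a : ok m S -> #|S| = n -> d \in S -> a \notin S ->
  ok (runs (metaop d a) m) (a |: (S :\ d)) /\ #|a |: (S :\ d)| = n.
Proof.
move=> okm cS dS aS; have cSd := cardsD1 d S; rewrite dS cS /= in cSd.
have naSd : a \notin S :\ d by rewrite in_setD1 (negbTE aS) andbF.
split; last by rewrite cardsU1 naSd cSd.
by apply: ok_ins => //; [apply: ok_del => //; apply: ok_qry | rewrite [in X in _ < X]cSd].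
Qed.

End Operations.

Arguments runs {U w} D s m.
Arguments accs {U w} D s m.
Arguments costs {U w} D s m.
Arguments ok {U w} D n m S.

(** * Counting lemmas *)

Lemma sum_card_disjoint (I J : finType) (F : I -> {set J}) :
  (forall i i' k, k \in F i -> k \in F i' -> i = i') ->
  \sum_i #|F i| <= #|J|.
Proof.
move=> disj; under eq_bigr do rewrite -sum1_card big_mkcond.
rewrite exchange_big -sum1_card leq_sum // => k _.
rewrite -big_mkcond sum1_card; apply/card_le1_eqP => i i' ki ki'.
exact: (disj _ _ k ki' ki).
Qed.

Lemma sum_card_fibre (T I : finType) (A : {set T}) (f : T -> I) :
  \sum_i #|[set t in A | f t == i]| = #|A|.
Proof.
rewrite -sum1_card (partition_big f xpredT) //=.
by apply: eq_bigr => i _; rewrite -sum1_card; apply: eq_bigl => t; rewrite inE.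
Qed.

Lemma sqr_sum_leq (I : finType) (f : I -> nat) :
  (\sum_i f i) ^ 2 <= #|I| * \sum_i f i ^ 2.
Proof.
have e : (\sum_i f i) ^ 2 = \sum_i \sum_j f i * f j.
  by rewrite -mulnn big_distrl; apply: eq_bigr => i _; rewrite big_distrr.
have e2 : 2 * (#|I| * \sum_i f i ^ 2) = \sum_i \sum_j (f i ^ 2 + f j ^ 2).
  under [RHS]eq_bigr do rewrite big_split /= sum_nat_const.
  by rewrite big_split /= sum_nat_const -big_distrr /= mul2n addnn.
rewrite -(leq_pmul2l (isT : 0 < 2)) e2 e big_distrr /=.
apply: leq_sum => i _; rewrite big_distrr /=; apply: leq_sum => j _.
exact: nat_Cauchy.
Qed.

(** Each pair of bounds multiplies to [n ^ 2 <= e * (x * y)]; the rest is the arithmetic-geometric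
    mean inequality for [x * y'] and [x' * y]. *)
Lemma AGM_scaled n n' e x y x' y' :
  n <= e -> n <= x * y -> n' <= e -> n' <= x' * y' ->
  2 * (n * n') <= e * (x * y' + x' * y).
Proof.
move=> ne nxy ne' nxy'; rewrite -leq_sqr !expnMn.
have /leq_trans -> // : 2 ^ 2 * (n ^ 2 * n' ^ 2) <= 2 ^ 2 * ((e * (x * y)) * (e * (x' * y'))).
  by rewrite leq_mul2l /= -!mulnn; apply: leq_mul; apply: leq_mul.
have -> : 2 ^ 2 * (e * (x * y) * (e * (x' * y'))) = e ^ 2 * (4 * ((x * y') * (x' * y))).
  by rewrite -mulnn; lia.
by rewrite leq_mul2l nat_AGM2 orbT.
Qed.

(** If [g] is a function of [(z, x)] and also of [(z, y)], then for fixed [z] the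
    set [A] is a disjoint union of rectangles indexed by the values of [g], each of
    them of size at most the number of values of [h]. *)
Lemma common_information (T X Y Z H G : finType) (A : {set T})
    (x : T -> X) (y : T -> Y) (z : T -> Z) (h : T -> H) (g : T -> G) :
  {in A &, forall t u, z t = z u -> x t = x u -> y t = y u -> t = u} ->
  {in A &, forall t u, z t = z u -> x t = x u -> g t = g u} ->
  {in A &, forall t u, z t = z u -> y t = y u -> g t = g u} ->
  {in A &, forall t u, h t = h u -> z t = z u} ->
  {in A &, forall t u, h t = h u -> g t = g u -> t = u} ->
  #|A| ^ 2 <= #|Z| * (#|X| * #|Y| * #|H|).
Proof.
move=> inj gx gy hz hg.
pose Az c := [set t in A | z t == c]; pose Ag c e := [set t in Az c | g t == e].
have AgP c e t : t \in Ag c e -> [/\ t \in A, z t = c & g t = e].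
  by rewrite !inE => /andP[/andP[-> /eqP-> /eqP->]].
have cardAg c e : #|Ag c e| <= #|x @: Ag c e| * #|y @: Ag c e|.
  rewrite -cardsX -(card_in_imset (f := fun t => (x t, y t))); last first.
    move=> t u /AgP[tA tz _] /AgP[uA uz _] [ex ey].
    by apply: inj => //; rewrite tz uz.
  apply: subset_leq_card; apply/subsetP => _ /imsetP[t tA ->].
  by rewrite in_setX !imset_f.
have cardAgh c e : #|Ag c e| <= #|h @: Az c|.
  rewrite -(card_in_imset (f := h)); last first.
    by move=> t u /AgP[tA _ tg] /AgP[uA _ ug] e'; apply: hg => //; rewrite tg ug.
  by apply: subset_leq_card; apply: imsetS; apply/subsetP => t; rewrite inE => /andP[].
have cardAz c : #|Az c| ^ 2 <= #|h @: Az c| * (#|X| * #|Y|).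
  rewrite -(leq_pmul2l (isT : 0 < 2)) -(sum_card_fibre (Az c) g) -mulnn.
  rewrite big_distrl big_distrr /=.
  (* For fixed [z], either coordinate determines [g], so classes with different values of [g] have
     disjoint projections. *)
  have sX : \sum_e #|x @: Ag c e| <= #|X|.
    apply: sum_card_disjoint => e e' k /imsetP[t /AgP[tA tz <-] ->].
    by move=> /imsetP[u /AgP[uA uz <-] ?]; apply: gx => //; rewrite tz uz.
  have sY : \sum_e #|y @: Ag c e| <= #|Y|.
    apply: sum_card_disjoint => e e' k /imsetP[t /AgP[tA tz <-] ->].
    by move=> /imsetP[u /AgP[uA uz <-] ?]; apply: gy => //; rewrite tz uz.
  (* Doubling and symmetrising in the two indices brings the cross terms into the form of
     [AGM_scaled]. *)
  have e : 2 * (#|h @: Az c| * ((\sum_e #|x @: Ag c e|) * (\sum_e #|y @: Ag c e|))) =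
      \sum_e \sum_e' #|h @: Az c| * (#|x @: Ag c e| * #|y @: Ag c e'| +
                                     #|x @: Ag c e'| * #|y @: Ag c e|).
    under [RHS]eq_bigr do rewrite -big_distrr /= big_split /= -big_distrr -big_distrl /=.
    by rewrite -big_distrr /= big_split /= -big_distrl -big_distrr /= addnn -mul2n mulnCA.
  apply: (@leq_trans (2 * (#|h @: Az c| * ((\sum_e #|x @: Ag c e|) * (\sum_e #|y @: Ag c e|))))).
    rewrite e; apply: leq_sum => i _; rewrite big_distrr big_distrr /=.
    by apply: leq_sum => j _; apply: AGM_scaled; rewrite ?cardAg ?cardAgh.
  by rewrite leq_mul2l /= leq_mul2l; apply/orP; right; apply: leq_mul.
have sH : \sum_c #|h @: Az c| <= #|H|.
  apply: sum_card_disjoint => c c' k /imsetP[t]; rewrite inE => /andP[tA /eqP<-] ->.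
  by case/imsetP=> u; rewrite inE => /andP[uA /eqP<-] /hz; apply.
rewrite -(sum_card_fibre A z); apply: leq_trans (sqr_sum_leq _) _.
rewrite leq_mul2l; apply/orP; right.
apply: leq_trans (_ : \sum_c #|h @: Az c| * (#|X| * #|Y|) <= _).
  by apply: leq_sum => c _; apply: cardAz.
by rewrite -big_distrl /= mulnC leq_mul2l sH orbT.
Qed.

(** A set of at most [k] elements is listed by a [k]-tuple over [option T], padded with [None]. *)
Lemma card_small_sets (T : finType) k :
  #|[set E : {set T} | #|E| <= k]| <= #|T|.+1 ^ k.
Proof.
pose f (t : {ffun 'I_k -> option T}) := [set x | [exists i, t i == Some x]].
have -> : #|T|.+1 ^ k = #|[set: {ffun 'I_k -> option T}]|.
  by rewrite cardsT card_ffun card_option card_ord.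
apply: leq_trans (leq_imset_card f _); apply: subset_leq_card.
apply/subsetP => E; rewrite inE => cE; apply/imsetP.
exists [ffun i : 'I_k => onth (enum E) i] => //.
apply/setP => x; rewrite inE; apply/idP/existsP => [xE | [i]].
  have /onthP[i ei] : x \in enum E by rewrite mem_enum.
  have ik : i < k by apply: leq_trans cE; rewrite cardE -onthTE ei.
  by exists (Ordinal ik); rewrite ffunE /= ei.
rewrite ffunE => /eqP e.
by rewrite -mem_enum; apply/onthP; exists i.
Qed.

(** Choose the set of disagreements, then the new values on it. *)
Lemma card_hamming_ball (I : finType) (B h : nat) (f : {ffun I -> 'I_B}) :
  0 < B ->
  #|[set f' : {ffun I -> 'I_B} | #|[set i | f i != f' i]| <= h]|
    <= 2 ^ #|I| * B ^ h.
Proof.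
case: B f => // B f _; set A := [set _ | _].
rewrite -(sum_card_fibre A (fun f' : {ffun I -> 'I_B.+1} => [set i | f i != f' i])).
apply: (@leq_trans (\sum_(E : {set I}) B.+1 ^ h)); last first.
  by rewrite sum_nat_const -[X in X * _]cardsT -powersetT card_powerset cardsT.
apply: leq_sum => E _.
have [cE|cE] := leqP #|E| h; last first.
  rewrite (_ : [set _ in _ | _] = set0) ?cards0 //; apply/setP => f'; rewrite !inE.
  by apply/negP => /andP[le /eqP eE]; move: le; rewrite eE leqNgt cE.
pose merge (e : {ffun I -> 'I_B.+1}) := [ffun i => if i \in E then e i else f i].
apply: leq_trans (_ : #|pffun_on ord0 E predT| <= _); last first.
  by rewrite card_pffun_on cardT size_enum_ord; apply: leq_pexp2l.
apply: leq_trans (leq_imset_card merge _); apply: subset_leq_card.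
apply/subsetP => f'; rewrite !inE => /andP[_ /eqP eE].
apply/imsetP; exists [ffun i => if i \in E then f' i else ord0].
  apply/pffun_onP; split=> [|i _] //.
  by apply/subsetP => i; rewrite inE ffunE; case: ifP => //; rewrite eqxx.
apply/ffunP => i; rewrite !ffunE; have [// | ] := boolP (i \in E).
by rewrite -eE inE negbK => /eqP.
Qed.

(** A random colouring separates two distinct labels with probability one half, hence on average
    half of the positions where [f] and [f'] differ. *)
Lemma separating_colouring (I : finType) (B : nat) (f f' : {ffun I -> 'I_B}) :
  exists c : {ffun 'I_B -> bool},
    #|[set i | f i != f' i]| <= 2 * #|[set i | c (f i) != c (f' i)]|.
Proof.
have half (j j' : 'I_B) : j != j' ->
    2 * #|[set c : {ffun 'I_B -> bool} | c j != c j']| = 2 ^ B.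
  move=> jj'; set A := [set _ | _].
  (* Changing the colour of [j] exchanges the colourings that separate [j] from [j'] with those that
     do not. *)
  pose flip (c : {ffun 'I_B -> bool}) := [ffun i => c i (+) (i == j)].
  have flipK : involutive flip.
    by move=> c; apply/ffunP => i; rewrite !ffunE -addbA addbb addbF.
  have -> : 2 ^ B = #|{ffun 'I_B -> bool}| by rewrite card_ffun card_bool card_ord.
  rewrite -(cardsC A) mul2n -addnn; congr (_ + _).
  rewrite -(card_imset A (inv_inj flipK)); apply: eq_card => c; rewrite -[c in LHS]flipK (mem_imset _ _ (inv_inj flipK)).
  rewrite !inE !ffunE eqxx [j' == j]eq_sym (negbTE jj') addbT addbF.
  by case: (c j); case: (c j').
apply/existsP; apply: contraT => /existsPn none.
set d := #|[set i | f i != f' i]| in none.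
have : \sum_(c : {ffun 'I_B -> bool}) 2 * #|[set i | c (f i) != c (f' i)]| < 2 ^ B * d.
  have d0 : 0 < d by have := none [ffun=> true]; rewrite -ltnNge; apply: leq_ltn_trans.
  have -> : 2 ^ B * d = \sum_(c : {ffun 'I_B -> bool}) d.
    by rewrite sum_nat_const card_ffun card_bool card_ord.
  (* One colouring, here the constant one, is split off to make the inequality strict. *)
  rewrite (bigD1 [ffun=> true]) //= [X in _ < X](bigD1 [ffun=> true]) //=.
  rewrite -addSn; apply: leq_add; first by have := none [ffun=> true]; rewrite -ltnNge.
  by apply: leq_sum => c _; have := none c; rewrite -ltnNge => /ltnW.
rewrite ltnNge => /negP; case.
rewrite -big_distrr /=; under eq_bigr do rewrite -sum1_card big_mkcond.
rewrite exchange_big /= big_distrr /= mulnC /d -sum1_card big_distrl /= big_mkcond.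
apply: leq_sum => i _; rewrite inE; case: ifP => // /half <-.
rewrite mul1n leq_mul2l /= -sum1_card big_mkcond; apply: leq_sum => c _.
by rewrite !inE.
Qed.

(** The product of the [n] factors from [n + 1] to [2 * n] is at least [n ^ n], and it is a central
    binomial coefficient, at most [4 ^ n], times the factorial. *)
Lemma expn_self_leq_fact n : n ^ n <= 4 ^ n * n`!.
Proof.
have expn_ffact k : n ^ k <= (n + k) ^_ k.
  elim: k => // k IH; rewrite addnS ffactSS expnS leq_mul // leqW //.
  exact: leq_addr.
apply: leq_trans (expn_ffact n) _; rewrite -bin_ffact leq_mul2r.
apply/orP; right; rewrite (_ : 4 ^ n = (1 + 1) ^ (n + n)); last first.
  by rewrite expnD -expnMn.
rewrite expnDn (bigD1 (inord n : 'I_(n + n).+1)) //= inordK ?ltnS ?leq_addr //.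
by rewrite !exp1n !muln1 leq_addr.
Qed.

(** * Two runs through the children of a node *)

Lemma runs_local U w (D : dict U w) s m1 m2 (C : {set 'I_(cells D)}) :
  accs D s m1 \subset C -> {in C, m1 =1 m2} ->
  accs D s m2 = accs D s m1 /\ {in C, runs D s m1 =1 runs D s m2}.
Proof.
elim: s m1 m2 => [|o s IH] m1 m2 //=; rewrite subUset => /andP[sC sC'] e12.
have [_ -> e12'] := run_local sC e12.
by have [-> ?] := IH _ _ sC' e12'.
Qed.

Section Node.
Variables (U w : nat) (D : dict U w) (n q B m : nat).
Local Notation M := (cells D).
Local Notation W := (2 ^ w).
Local Notation memory := (Defs.mem M W).
Local Notation keys := ({ffun 'I_n -> 'I_q} * {ffun 'I_m * 'I_B -> 'I_q})%type.
Local Notation sigma := {ffun 'I_m -> 'S_B}.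
Variables (key0 : 'I_n -> 'I_q -> 'I_U) (keyA : 'I_m * 'I_B -> 'I_q -> 'I_U).
Variables (dslot : 'I_B * 'I_m -> 'I_n) (M0 : {ffun 'I_n -> 'I_q} -> memory).
Hypothesis key0_inj : forall t v t' v', key0 t v = key0 t' v' -> t = t' /\ v = v'.
Hypothesis keyA_inj : forall p v p' v', keyA p v = keyA p' v' -> p = p' /\ v = v'.
Hypothesis key0A : forall t v p v', key0 t v <> keyA p v'.
Hypothesis dslot_inj : injective dslot.
Hypothesis M0_ok : forall f, ok D n (M0 f) [set key0 t (f t) | t : 'I_n].
Implicit Types (k : keys) (s : sigma) (P : {set 'I_B * 'I_m}) (e : 'I_B * 'I_m).

(** The meta-operation [e = (j, i)], the [i]-th one of child [j], deletes the key of
    slot [dslot e] and inserts the key of slot [aslot s e].  The key tells its slot,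
    but the permutation [s i] hides the child that inserts it. *)
Definition label s (p : 'I_m * 'I_B) : 'I_B := s p.1 p.2.
Definition aslot s e : 'I_m * 'I_B := (e.2, (s e.2)^-1%g e.1).

Lemma aslotK s p : aslot s (label s p, p.1) = p.
Proof. by case: p => i c; rewrite /aslot /label /= permK. Qed.

Lemma label_aslot s e : label s (aslot s e) = e.1.
Proof. by rewrite /label /aslot /= permKV. Qed.

Lemma aslot_inj s : injective (aslot s).
Proof. by move=> [j i] [j' i'] [<- /perm_inj ->]. Qed.

Definition dkey k e := key0 (dslot e) (k.1 (dslot e)).
Definition akey k s e := keyA (aslot s e) (k.2 (aslot s e)).

(** [P] is the set of meta-operations already carried out; the content does not depend on their
    order. *)
Definition content k s P :=
  [set key0 t (k.1 t) | t in ~: (dslot @: P)] :|: [set akey k s e | e in P].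

Lemma content_key0 k s P t v :
  key0 t v \in content k s P -> t \notin dslot @: P /\ v = k.1 t.
Proof.
rewrite inE => /orP[/imsetP[t']|/imsetP[e _ /key0A//]].
by rewrite inE => tP /key0_inj[-> ->].
Qed.

Lemma content_keyA k s P p v :
  keyA p v \in content k s P -> exists2 e, e \in P & p = aslot s e /\ v = k.2 p.
Proof.
rewrite inE => /orP[/imsetP[t' _ /esym/key0A//]|/imsetP[e eP /keyA_inj[-> ->]]].
by exists e.
Qed.

Lemma content0 k s : content k s set0 = [set key0 t (k.1 t) | t : 'I_n].
Proof.
by rewrite /content !imset0 setU0; apply/setP => x; apply/imsetP/imsetP => -[t _ ->];
  exists t; rewrite ?inE.
Qed.

Lemma card_content0 k s : #|content k s set0| = n.
Proof.
by rewrite content0 card_imset ?card_ord // => t t' /key0_inj[].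
Qed.

Section Step.
Variables (k : keys) (s : sigma) (P : {set 'I_B * 'I_m}) (e : 'I_B * 'I_m).
Hypothesis eP : e \notin P.

Lemma dkey_content : dkey k e \in content k s P.
Proof.
rewrite inE; apply/orP; left; apply/imsetP; exists (dslot e) => //.
by rewrite inE mem_imset.
Qed.

Lemma akey_content : akey k s e \notin content k s P.
Proof.
by apply/negP => /content_keyA[e' e'P [/aslot_inj ee' _]]; move: eP; rewrite ee' e'P.
Qed.

Lemma content_step :
  akey k s e |: (content k s P :\ dkey k e) = content k s (e |: P).
Proof.
apply/setP => x; rewrite /content !imsetU1 !inE; case: eqP => [-> | _] /=.
  by rewrite orbT.
case: eqP => [-> | xd] /=.
  apply/esym/negbTE/negP => /orP[/imsetP[t]|/imsetP[e' _ /key0A//]].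
  by rewrite !inE negb_or => /andP[/eqP te _] /key0_inj[/esym/te].
congr (_ || _); apply/imsetP/imsetP => -[t tP xt]; exists t => //.
  move: tP; rewrite !inE negb_or => ->; rewrite andbT; apply/eqP => te.
  by apply: xd; rewrite xt te.
by move: tP; rewrite !inE negb_or => /andP[].
Qed.

End Step.

(** * Running the meta-operations through the children *)

Definition metas k s (es : seq ('I_B * 'I_m)) :=
  flatten [seq metaop (dkey k e) (akey k s e) | e <- es].

Lemma ok_metas k s es mem P :
  ok D n mem (content k s P) -> #|content k s P| = n -> uniq es ->
  {in es, forall e, e \notin P} ->
  ok D n (runs D (metas k s es) mem) (content k s (P :|: [set e in es])) /\
  #|content k s (P :|: [set e in es])| = n.
Proof.
elim: es mem P => [|e es IH] mem P okm cP.
  by rewrite (_ : [set e in [::]] = set0) ?setU0 //; apply/setP=> e; rewrite !inE.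
move=> /andP[ees ues] nP.
rewrite [metas _ _ _](_ : _ = metaop (dkey k e) (akey k s e) ++ metas k s es) // runs_cat.
have eP : e \notin P by apply: nP; rewrite mem_head.
have := ok_metaop okm cP (dkey_content k s eP) (akey_content k s eP).
rewrite content_step // => -[okm' cP'].
rewrite (_ : P :|: _ = (e |: P) :|: [set e in es]); last first.
  by apply/setP => e'; rewrite !inE; case: eqP; rewrite /= ?orbT.
apply: IH => // e' e'es; rewrite !inE negb_or nP ?andbT; last by rewrite inE e'es orbT.
by apply: contraNneq ees => <-.
Qed.

(** Since a cell-probe program only sees the cells it probes, the successive
    deleted keys are recovered one by one: the true query for the next one answers
    yes in the other memory as well, where its slot holds a single key. *)
Lemma metas_det k k' s es m1 m2 P (C : {set 'I_M}) :
  ok D n m1 (content k s P) -> #|content k s P| = n ->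
  ok D n m2 (content k' s P) -> #|content k' s P| = n ->
  uniq es -> {in es, forall e, e \notin P} ->
  accs D (metas k s es) m1 \subset C -> {in C, m1 =1 m2} ->
  {in es, forall e, k.2 (aslot s e) = k'.2 (aslot s e)} ->
  {in es, forall e, k.1 (dslot e) = k'.1 (dslot e)} /\
  {in C, runs D (metas k s es) m1 =1 runs D (metas k' s es) m2}.
Proof.
elim: es m1 m2 P => [|e es IH] m1 m2 P ok1 c1 ok2 c2.
  by move=> _ _ _ e12 _; split.
move=> /andP[ees ues] nP.
have -> k0 : metas k0 s (e :: es) = metaop (dkey k0 e) (akey k0 s e) ++ metas k0 s es.
  by [].
rewrite accs_cat !runs_cat subUset => /andP[sC1 sC2] e12 eA.
have eP : e \notin P by apply: nP; rewrite mem_head.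
have ed : k.1 (dslot e) = k'.1 (dslot e).
  have sQ : acc (alg D (Qry (dkey k e))) m1 \subset C.
    by apply: subset_trans sC1; rewrite /= subsetUl.
  have [eans _ _] := run_local sQ e12.
  move: eans; rewrite (ok_ans _ ok1) (ok_ans _ ok2) dkey_content // => /content_key0.
  by case.
have ea : akey k' s e = akey k s e by rewrite /akey eA // mem_head.
have ed' : dkey k' e = dkey k e by rewrite /dkey ed.
have [_ e12'] := runs_local sC1 e12.
have [ok1' c1'] := ok_metaop ok1 c1 (dkey_content k s eP) (akey_content k s eP).
have [ok2' c2'] := ok_metaop ok2 c2 (dkey_content k' s eP) (akey_content k' s eP).
rewrite !content_step // in ok1' c1' ok2' c2'.
rewrite ea ed' in ok2' *.
have [||eD eR] := IH _ _ _ ok1' c1' ok2' c2' ues _ sC2 e12'.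
- move=> e' e'es; rewrite !inE negb_or nP ?andbT; last by rewrite inE e'es orbT.
  by apply: contraNneq ees => <-.
- by move=> e' e'es; apply: eA; rewrite inE e'es orbT.
by split=> // e'; rewrite inE => /predU1P[-> | /eD].
Qed.

Definition child_list (j : 'I_B) := [seq (j, i) | i <- enum 'I_m].
Definition child k s j := metas k s (child_list j).

Fixpoint mems k s (j : nat) : memory :=
  if j is j'.+1 then
    runs D (if insub j' is Some i then child k s i else [::]) (mems k s j')
  else M0 k.1.

Definition final k s := mems k s B.
Definition touched k s (j : 'I_B) := accs D (child k s j) (mems k s j).

Lemma memsS k s (j : 'I_B) : mems k s j.+1 = runs D (child k s j) (mems k s j).
Proof. by rewrite /= insubT //= => lt; congr (runs D (child k s _)); apply: val_inj. Qed.

Lemma uniq_child_list j : uniq (child_list j).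
Proof. by rewrite map_inj_uniq ?enum_uniq // => i i' []. Qed.

Lemma mem_child_list j e : (e \in child_list j) = (e.1 == j).
Proof.
apply/mapP/eqP => [[i _ ->] // | <-].
by exists e.2; rewrite ?mem_enum //; case: e.
Qed.

Lemma mems_ok k s (j : nat) : j <= B ->
  ok D n (mems k s j) (content k s [set e : 'I_B * 'I_m | e.1 < j]) /\
  #|content k s [set e : 'I_B * 'I_m | e.1 < j]| = n.
Proof.
elim: j => [_|j IH lt].
  rewrite (_ : [set e : 'I_B * 'I_m | _] = set0); last by apply/setP=> e; rewrite !inE.
  by split; [rewrite content0; apply: M0_ok | apply: card_content0].
have [okj cj] := IH (ltnW lt); rewrite (memsS k s (Ordinal lt)).
rewrite (_ : [set e : 'I_B * 'I_m | e.1 < j.+1] =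
             [set e : 'I_B * 'I_m | e.1 < j] :|: [set e in child_list (Ordinal lt)]); last first.
  by apply/setP => e; rewrite !inE mem_child_list ltnS leq_eqVlt orbC.
apply: ok_metas => //; first exact: uniq_child_list.
by move=> e; rewrite mem_child_list inE => /eqP->; rewrite ltnn.
Qed.

Lemma mems_notin k s c (i j : nat) : i <= j -> j <= B ->
  (forall l : 'I_B, i <= l < j -> c \notin touched k s l) ->
  mems k s j c = mems k s i c.
Proof.
elim: j => [|j IH]; first by rewrite leqn0 => /eqP->.
rewrite leq_eqVlt => /predU1P[-> // | ij] jB nT.
rewrite (memsS k s (Ordinal jB)) runs_notin; last by apply: nT; rewrite /= -ltnS ij /=.
apply: IH => //; first exact: ltnW.
by move=> l /andP[il lj]; apply: nT; rewrite il ltnW.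
Qed.

(** The final memory reveals the final content: the keys outside the deleted slots and all inserted
    keys. Each key tells its slot, so the permutations may differ. *)
Lemma final_inj k k' s s' :
  (forall e, k.1 (dslot e) = k'.1 (dslot e)) -> final k s = final k' s' -> k = k'.
Proof.
move=> ed ef; have [o1 _] := mems_ok k s (leqnn B).
have [o2 _] := mems_ok k' s' (leqnn B).
rewrite -/(final _ _) -ef in o2; rewrite -/(final _ _) in o1.
have := ok_inj o1 o2.
have -> : [set e : 'I_B * 'I_m | e.1 < B] = setT by apply/setP => e; rewrite !inE ltn_ord.
case: k k' ed o1 o2 ef => [f a] [f' a'] /= ed _ _ _ ec; congr pair; apply/ffunP.
  move=> t; have [/imsetP[e _ ->] // | nt] := boolP (t \in [set dslot e | e in setT]).
  have : key0 t (f t) \in content (f, a) s setT by rewrite inE imset_f // inE.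
  by rewrite ec => /content_key0[].
move=> p; have : keyA p (a p) \in content (f, a) s setT.
  rewrite inE; apply/orP; right; apply/imsetP; exists (label s p, p.1) => //.
  by rewrite /akey aslotK.
by rewrite ec => /content_keyA[e _ []].
Qed.

(** * Cells owned by one child and cells shared by several *)

Definition owner k s : {ffun 'I_M -> option 'I_B} :=
  [ffun c => [pick j | (c \in touched k s j) &&
                       [forall i, (c \in touched k s i) ==> (i == j)]]].

Lemma ownerP k s c j : owner k s c = Some j <->
  c \in touched k s j /\ (forall i, c \in touched k s i -> i = j).
Proof.
rewrite ffunE; case: pickP => [j' /andP[cj' /forallP un] | none]; split => //.
- move=> [<-]; split => // i ci; have := un i; rewrite ci => /eqP; exact.
- by move=> [cj uj]; rewrite (uj _ cj').
- move=> [cj uj]; have := none j; rewrite cj => /negP; case; apply/forallP=> i.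
  by apply/implyP => /uj ->.
Qed.

(** An owner [None] also occurs for the cells that no child touches, which are excluded here. *)
Definition shared k s : {set 'I_M} :=
  [set c | (owner k s c == None) && [exists j, c \in touched k s j]].

Definition shared_pairs k s : {set 'I_B * 'I_M} :=
  [set p : 'I_B * 'I_M | (p.2 \in touched k s p.1) && (p.2 \in shared k s)].

Definition shared_view k s : {set 'I_B * 'I_M * 'I_W} :=
  [set (p, mems k s p.1 p.2) | p : 'I_B * 'I_M in shared_pairs k s].

(** The owner map and the shared view, both part of the advice, already tell which cells a child
    touches. *)
Lemma touchedE k s j c : (c \in touched k s j) =
  (owner k s c == Some j) || [exists v, (j, c, v) \in shared_view k s].
Proof.
apply/idP/orP => [cT | [/eqP/ownerP[] // | /existsP[v /imsetP[[j' c']]]]].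
  have [[j' eo]|eo] : (exists i, owner k s c = Some i) \/ owner k s c = None.
  - by case: (owner k s c) => [i|]; [left; exists i | right].
  - by left; have /ownerP[_ un] := eo; rewrite eo (un _ cT).
  right; apply/existsP; exists (mems k s j c); apply/imsetP.
  exists (j, c) => //; rewrite !inE /= cT eo eqxx /=; apply/existsP; by exists j.
by rewrite inE => /andP[cT _] [-> -> _].
Qed.

Lemma shared_viewP k s j c v : (j, c, v) \in shared_view k s ->
  v = mems k s j c.
Proof. by case/imsetP => -[j' c'] _ [-> -> ->]. Qed.

Lemma owner_mems k s c j : owner k s c = Some j -> mems k s j c = M0 k.1 c.
Proof.
move=> /ownerP[_ un]; rewrite (@mems_notin k s c 0 j) ?(ltnW (ltn_ord j)) // => l lj.
by apply/negP => /un e; move: lj; rewrite e ltnn.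
Qed.

Lemma owner_final k s c j : owner k s c = Some j -> final k s c = mems k s j.+1 c.
Proof.
move=> /ownerP[_ un]; rewrite /final (@mems_notin k s c j.+1 B) // => l /andP[lj _].
by apply/negP => /un e; move: lj; rewrite e ltnn.
Qed.

Lemma untouched_final k s c : (forall j, c \notin touched k s j) ->
  final k s c = M0 k.1 c.
Proof. by move=> nT; rewrite /final (@mems_notin k s c 0 B). Qed.

(** A cell probed by child [j] is either its own, and still as in [M0], or shared, with its content
    in the shared view; so [metas_det] applies. *)
Lemma child_det k k' s j :
  owner k s = owner k' s -> shared_view k s = shared_view k' s ->
  (forall c, owner k s c = Some j -> M0 k.1 c = M0 k'.1 c) ->
  (forall p, label s p = j -> k.2 p = k'.2 p) ->
  (forall i, k.1 (dslot (j, i)) = k'.1 (dslot (j, i))) /\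
  (forall c, owner k s c = Some j -> final k s c = final k' s c).
Proof.
move=> eo ev eM ea.
have [ok1 c1] := mems_ok k s (ltnW (ltn_ord j)).
have [ok2 c2] := mems_ok k' s (ltnW (ltn_ord j)).
have agree : {in touched k s j, mems k s j =1 mems k' s j}.
  move=> c; rewrite touchedE => /orP[/eqP co | /existsP[v cv]].
    by rewrite !owner_mems -?eo // eM.
  by rewrite -(shared_viewP cv); rewrite ev in cv; rewrite (shared_viewP cv).
have [||eD eR] := metas_det ok1 c1 ok2 c2 (uniq_child_list j) _ (subxx _) agree.
- by move=> e; rewrite mem_child_list inE => /eqP->; rewrite ltnn.
- by move=> e; rewrite mem_child_list => /eqP ej; apply: ea; rewrite label_aslot.
split=> [i | c co]; first by apply: eD; rewrite mem_child_list.
have co' : owner k' s c = Some j by rewrite -eo.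
rewrite (owner_final co) (owner_final co') !memsS; apply: eR.
by have /ownerP[] := co.
Qed.

Definition good x k s :=
  \sum_j #|touched k s j| <= #|\bigcup_j touched k s j| + x.

(** A cell touched by [mu >= 2] children contributes [mu - 1] to the excess of the sum over the
    union, and both [1 <= mu - 1] and [mu <= 2 * (mu - 1)]. *)
Lemma leq_shared x k s : good x k s ->
  #|shared k s| <= x /\ #|shared_view k s| <= 2 * x.
Proof.
pose mu c := #|[set j | c \in touched k s j]|.
have mu2 c : c \in shared k s -> 1 < mu c.
  rewrite inE => /andP[/eqP co /existsP[j cj]]; rewrite ltnNge; apply/negP.
  move=> /card_le1_eqP le1; suff : owner k s c = Some j by rewrite co.
  by apply/ownerP; split=> // i ci; apply: le1; rewrite inE.
have mu0 c : (0 < mu c) = (c \in \bigcup_j touched k s j).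
  apply/card_gt0P/bigcupP => [[j] | [j _ cj]]; last by exists j; rewrite inE.
  by rewrite inE => cj; exists j.
have sT : \sum_j #|touched k s j| = \sum_c mu c.
  under eq_bigr do rewrite -sum1_card big_mkcond.
  rewrite exchange_big; apply: eq_bigr => c _.
  by rewrite -big_mkcond sum1_card /mu cardsE.
have sU : #|\bigcup_j touched k s j| = \sum_c (0 < mu c : nat).
  by rewrite -sum1_card big_mkcond; apply: eq_bigr => c _; rewrite mu0; case: ifP.
have sS : #|shared k s| = \sum_c (c \in shared k s : nat).
  by rewrite -sum1_card big_mkcond; apply: eq_bigr => c _; case: ifP.
have sV : #|shared_view k s| <= \sum_c (c \in shared k s) * mu c.
  apply: leq_trans (leq_imset_card _ _) _.
  rewrite -sum1_card big_mkcond (eq_bigr (fun p : 'I_B * 'I_M =>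
    if (p.1, p.2) \in shared_pairs k s then 1 else 0)); last by case.
  rewrite -(pair_bigA _ (fun j c => if (j, c) \in shared_pairs k s then 1 else 0)).
  rewrite exchange_big /=.
  apply: leq_sum => c _; rewrite /mu -sum1_card [X in _ * X]big_mkcond big_distrr /=.
  apply: leq_sum => j _; rewrite [_ \in shared_pairs _ _]inE [j \in _]inE /=.
  by case: (c \in touched k s j); case: (c \in shared k s).
rewrite /good sT sU => le.
have le1 : \sum_c (c \in shared k s : nat) + \sum_c (0 < mu c : nat) <= \sum_c mu c.
  by rewrite -big_split /=; apply: leq_sum => c _; case: (boolP (c \in _)) => [/mu2|_] /=; lia.
have le2 : \sum_c (c \in shared k s) * mu c + 2 * \sum_c (0 < mu c : nat)
    <= 2 * \sum_c mu c.
  rewrite !big_distrr -big_split /=; apply: leq_sum => c _.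
  by case: (boolP (c \in _)) => [/mu2|_] /=; lia.
by rewrite sS; split; lia.
Qed.

(** The deleted keys are the same in both runs, so the children coloured [true] can be replayed in
    run [s] and the others in run [s']. Only the data coloured [false] in [s] and [true] in [s'] are
    never consulted. *)
Lemma common_det s s' (chi : {ffun 'I_B -> bool}) k k' :
  owner k s = owner k' s -> owner k s' = owner k' s' ->
  shared_view k s = shared_view k' s -> shared_view k s' = shared_view k' s' ->
  final k s = final k s' -> final k' s = final k' s' ->
  (forall c, ~~ ((omap chi (owner k s c) == Some false) &&
                 (omap chi (owner k s' c) == Some true)) -> M0 k.1 c = M0 k'.1 c) ->
  (forall p, ~~ (~~ chi (label s p) && chi (label s' p)) -> k.2 p = k'.2 p) ->
  (forall e, k.1 (dslot e) = k'.1 (dslot e)) /\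
  (forall c, isSome (owner k s c) ->
     omap chi (owner k s c) = omap chi (owner k s' c) -> final k s c = final k' s c).
Proof.
move=> eo eo' ev ev' ef ef' eM ea.
have det j : chi j ->
    (forall i, k.1 (dslot (j, i)) = k'.1 (dslot (j, i))) /\
    (forall c, owner k s c = Some j -> final k s c = final k' s c).
  move=> cj; apply: child_det => // [c co | p pj]; first by apply: eM; rewrite co /= cj.
  by apply: ea; rewrite pj cj.
have det' j : ~~ chi j ->
    (forall i, k.1 (dslot (j, i)) = k'.1 (dslot (j, i))) /\
    (forall c, owner k s' c = Some j -> final k s' c = final k' s' c).
  move=> /negbTE cj; apply: child_det => // [c co | p pj].
    by apply: eM; rewrite co /= cj andbF.
  by apply: ea; rewrite pj cj andbF.
split=> [[j i] | c].
  by have [/det[]|/det'[]] := boolP (chi j).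
case co: (owner k s c) => [j|] // _ /=.
have [/det[_ H] _|cj] := boolP (chi j); first exact: H.
case co': (owner k s' c) => [j'|] //= [ecj].
by rewrite ef ef'; have [_] := det' j' (negbT (esym ecj)); apply.
Qed.

Definition restrict (T V : finType) (P : pred T) (f : T -> V) :
  {ffun {x | P x} -> V} := [ffun u => f (val u)].

Lemma restrict_eq (T V : finType) (P : pred T) (f g : T -> V) :
  restrict P f = restrict P g -> forall x, P x -> f x = g x.
Proof. by move=> /ffunP e x Px; have := e (exist _ x Px); rewrite !ffunE. Qed.

Lemma eq_restrict (T V : finType) (P : pred T) (f g : T -> V) :
  (forall x, P x -> f x = g x) -> restrict P f = restrict P g.
Proof. by move=> e; apply/ffunP => -[x Px]; rewrite !ffunE /= e. Qed.

Definition shared_final k s s' : {set 'I_M * 'I_W} :=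
  [set (c, final k s c) | c in shared k s :|: shared k s'].

Definition differ (chi : {ffun 'I_B -> bool}) s s' p :=
  chi (label s p) != chi (label s' p).

(** This is [common_information], where [x] and [y] are the data of opposite colours in the two runs
    and [z] is the rest. In the product of the four counts the keys of opposite colours enter once,
    everything else twice; this saves one factor [q] per such key. *)
Lemma fibre_bound s s' (chi : {ffun 'I_B -> bool}) (A : {set keys}) :
  {in A &, forall k k', [/\ owner k s = owner k' s, owner k s' = owner k' s',
     shared_view k s = shared_view k' s, shared_view k s' = shared_view k' s' &
     shared_final k s s' = shared_final k' s s']} ->
  {in A, forall k, final k s = final k s'} ->
  #|A| ^ 2 * q ^ #|[set p | differ chi s s' p]| <= (W ^ M * q ^ (m * B)) ^ 2.
Proof.
have [-> _ _|[k0 k0A] cst fin] := set_0Vmem A; first by rewrite cards0.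
pose col c := omap chi (owner k0 s c); pose col' c := omap chi (owner k0 s' c).
pose O b c := (col c == Some b) && (col' c == Some (~~ b)).
pose P b p := (chi (label s p) == b) && (chi (label s' p) == ~~ b).
(* Cells whose owner is [None] in one of the runs are neutral too. *)
pose zO c := ~~ O true c && ~~ O false c.
pose zP p := ~~ P true p && ~~ P false p.
pose R c := (col c == col' c) && isSome (owner k0 s c).
pose view (Q : pred 'I_M) (Q' : pred _) k := (restrict Q (M0 k.1), restrict Q' k.2).
pose g k := (restrict R (final k s), [ffun e => k.1 (dslot e)]).
(* With the advice, [g] and [h] give the final memory: [h] stores the cells of opposite colours, and
   a neutral cell has equal colours and lies in [g], or is shared and lies in the advice, or is
   unchanged from [M0]. *)
pose h k := ([ffun c => if zO c then M0 k.1 c else final k s c], restrict zP k.2).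
have view_eq (Q1 Q2 : pred 'I_M) (Q1' Q2' : pred _) k k' :
    view Q1 Q1' k = view Q1 Q1' k' -> view Q2 Q2' k = view Q2 Q2' k' ->
    (forall c, Q1 c || Q2 c -> M0 k.1 c = M0 k'.1 c) /\
    (forall p, Q1' p || Q2' p -> k.2 p = k'.2 p).
  move=> [/restrict_eq e1 /restrict_eq e1'] [/restrict_eq e2 /restrict_eq e2'].
  by split=> [c /orP[/e1|/e2]|p /orP[/e1'|/e2']].
have gdet b : {in A &, forall k k', view zO zP k = view zO zP k' ->
    view (O b) (P b) k = view (O b) (P b) k' -> g k = g k'}.
  move=> k k' kA k'A ez ex; have [eM ea] := view_eq _ _ _ _ _ _ ez ex.
  have [eo eo' ev ev' _] := cst _ _ kA k'A.
  have [eo0 eo0' _ _ _] := cst _ _ k0A kA.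
  have [ef ef'] := (fin _ kA, fin _ k'A).
  case: b ex eM ea => _ eM ea.
    have [||ed eR] := common_det (chi := chi) eo eo' ev ev' ef ef'.
    - move=> c Oc; apply: eM; rewrite /zO /O /= /col /col' eo0 eo0' Oc andbT.
      exact: orNb.
    - move=> p Pp; apply: ea; rewrite /zP /P /= eqb_id eqbF_neg eqbF_neg eqb_id Pp andbT.
      exact: orNb.
    congr pair; last by apply/ffunP => e; rewrite !ffunE.
    apply: eq_restrict => c /andP[/eqP]; rewrite /col /col' eo0 eo0' => ec so.
    exact: eR.
  (* The data left out are now those coloured [true] in [s] and [false] in [s'], so the two runs
     exchange roles. *)
  have [||ed eR] := common_det (chi := chi) eo' eo ev' ev (esym ef) (esym ef').
  - move=> c; rewrite andbC => Oc; apply: eM; rewrite /zO /O /= /col /col' eo0 eo0' Oc /=.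
    exact: orNb.
  - move=> p; rewrite andbC => Pp; apply: ea.
    rewrite /zP /P /= !eqbF_neg !eqb_id Pp /=; exact: orNb.
  congr pair; last by apply/ffunP => e; rewrite !ffunE.
  apply: eq_restrict => c /andP[/eqP]; rewrite /col /col' eo0 eo0' => ec so.
  rewrite ef ef'; apply: eR; last by rewrite ec.
  by move: ec so; case: (owner k s c); case: (owner k s' c).
have cE (T : finType) (Q : pred T) : #|Q| = \sum_x (Q x : nat).
  by rewrite -sum1_card big_mkcond; apply: eq_bigr => x _; rewrite unfold_in; case: (Q x).
have cOP (T : finType) (S : bool -> pred T) :
    (forall x, ~~ (S true x && S false x)) ->
    #|[pred x | ~~ S true x && ~~ S false x]| + (#|S true| + #|S false|) = #|T|.
  move=> disj; rewrite -[RHS]sum1_card !cE -!big_split.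
  apply: eq_bigr => x _ /=; have := disj x.
  by case: (S true x); case: (S false x).
have cO : #|zO| + (#|O true| + #|O false|) = M.
  rewrite -[RHS]card_ord -(cOP _ O) // => c; rewrite /O.
  by case: (col c) => [[]|]; rewrite /= ?andbF.
have cP : #|zP| + (#|P true| + #|P false|) = m * B.
  have <- : #|{: 'I_m * 'I_B}| = m * B by rewrite card_prod !card_ord.
  by rewrite -(cOP _ P) // => p; rewrite /P /=; case: (chi (label s p)); rewrite ?andbF.
have cd : #|[set p | differ chi s s' p]| = #|P true| + #|P false|.
  rewrite cardsE !cE -big_split; apply: eq_bigr => p _; rewrite /P /differ /=.
  by case: (chi _); case: (chi _).
have cV (Q : pred 'I_M) (Q' : pred ('I_m * 'I_B)) :
    #|{: {ffun {c | Q c} -> 'I_W} * {ffun {p | Q' p} -> 'I_q}}| = W ^ #|Q| * q ^ #|Q'|.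
  by rewrite card_prod !card_ffun !card_sig !card_ord.
have := @common_information _ _ _ _ _ _ A (view (O true) (P true))
  (view (O false) (P false)) (view zO zP) h g.
rewrite !cV card_prod !card_ffun card_sig !card_ord => H.
apply: (@leq_trans (W ^ #|zO| * q ^ #|zP| * (W ^ #|O true| * q ^ #|P true| *
   (W ^ #|O false| * q ^ #|P false|) * (W ^ M * q ^ #|zP|)) *
   q ^ #|[set p | differ chi s s' p]|)); last first.
  have -> : W ^ M = W ^ #|zO| * (W ^ #|O true| * W ^ #|O false|) by rewrite -!expnD cO.
  rewrite cd -cP !expnD -mulnn; apply: eq_leq.
  move: (W ^ _) (W ^ _) (W ^ _) (q ^ _) (q ^ _) (q ^ _) => x1 x2 x3 x4 x5 x6; lia.
rewrite leq_mul2r H ?orbT //.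
- move=> k k' kA k'A ez ex ey.
  have [e1 e1'] := view_eq _ _ _ _ _ _ ez ex.
  have [e2 e2'] := view_eq _ _ _ _ _ _ ez ey.
  have eM : M0 k.1 = M0 k'.1.
    apply: functional_extensionality => c.
    have [|] := boolP (zO c || O true c); first exact: e1.
    rewrite negb_or => /andP[nz nt]; apply: e2.
    by move: nz; rewrite /zO (negbTE nt) /= negbK => ->; rewrite orbT.
  have ea : k.2 = k'.2.
    apply/ffunP => p; have [|] := boolP (zP p || P true p); first exact: e1'.
    rewrite negb_or => /andP[nz nt]; apply: e2'.
    by move: nz; rewrite /zP (negbTE nt) /= negbK => ->; rewrite orbT.
  have := M0_ok k.1; rewrite eM => /(ok_inj (M0_ok k'.1)) ec.
  case: k k' kA k'A ea ec {ez ex ey e1 e1' e2 e2' eM} => [f a] [f' a'] /= _ _ -> ec.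
  congr pair; apply/ffunP => t.
  have : key0 t (f t) \in [set key0 t (f' t) | t : 'I_n] by rewrite ec imset_f.
  by case/imsetP => t' _ /key0_inj[-> ->].
- exact: (gdet true).
- exact: (gdet false).
- move=> k k' kA k'A [/ffunP eM /restrict_eq ea]; congr pair.
    by apply: eq_restrict => c zc; have := eM c; rewrite !ffunE zc.
  exact: eq_restrict.
- move=> k k' kA k'A [/ffunP eM /restrict_eq ea] [/restrict_eq eR /ffunP ed].
  have [eo eo' _ _ es] := cst _ _ kA k'A.
  have [eo0 eo0' _ _ _] := cst _ _ k0A kA.
  have shP k1 k2 c : k1 \in A -> k2 \in A -> c \in shared k1 s :|: shared k1 s' ->
      c \in shared k2 s :|: shared k2 s' /\ final k1 s c = final k2 s c.
    move=> k1A k2A cs; have [_ _ _ _ es12] := cst _ _ k1A k2A.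
    have : (c, final k1 s c) \in shared_final k2 s s' by rewrite -es12 imset_f.
    by case/imsetP => c' c's [-> ->].
  apply: (final_inj (s := s) (s' := s)); first by move=> e; have := ed e; rewrite !ffunE.
  apply: functional_extensionality => c.
  have [zc|nz] := boolP (zO c); last by have := eM c; rewrite !ffunE (negbTE nz).
  have eMc : M0 k.1 c = M0 k'.1 c by have := eM c; rewrite !ffunE zc.
  have [cs|ncs] := boolP (c \in shared k s :|: shared k s').
    by have [] := shP _ _ _ kA k'A cs.
  have ncs' : c \notin shared k' s :|: shared k' s'.
    by apply: contra ncs => cs; have [] := shP _ _ _ k'A kA cs.
  have unt k1 s1 : owner k1 s1 c = None -> c \notin shared k1 s1 ->
      final k1 s1 c = M0 k1.1 c.
    move=> co cn; apply: untouched_final => j; apply: contra cn => cj.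
    by rewrite inE co eqxx; apply/existsP; exists j.
  move: ncs ncs'; rewrite !in_setU !negb_or.
  move=> /andP[n1 n2] /andP[n1' n2'].
  case co: (owner k s c) => [j|]; last by rewrite !unt // -?eo.
  (* If the second run leaves the cell alone, the common final memory holds its initial content. *)
  case co': (owner k s' c) => [j'|]; last first.
    by rewrite (fin _ kA) (fin _ k'A) !unt // -?eo'.
  apply: eR; rewrite /R /col /col' eo0 eo0' co co' /= andbT.
  move: zc; rewrite /zO /O /col /col' eo0 eo0' co co' /=.
  by case: (chi j); case: (chi j').
Qed.

(** * Counting the good pairs of keys and permutations *)

Definition labels s : {ffun 'I_m * 'I_B -> 'I_B} := [ffun p => label s p].

Lemma labels_inj : injective labels.
Proof.
move=> s s' /ffunP e; apply/ffunP => i; apply/permP => c.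
by have := e (i, c); rewrite !ffunE.
Qed.

Definition memf (mem : memory) : {ffun 'I_M -> 'I_W} := [ffun c => mem c].

Lemma memf_inj : injective memf.
Proof.
move=> m1 m2 /ffunP e; apply: functional_extensionality => c.
by have := e c; rewrite !ffunE.
Qed.

Section Counting.
Variables (x h t : nat).
Hypotheses (q_gt0 : 0 < q) (B_gt0 : 0 < B) (th : 2 * t <= h.+1).

Local Notation pairs := (sigma * sigma * {ffun 'I_B -> bool})%type.

Definition confused k (u : pairs) :=
  [&& good x k u.1.1, good x k u.1.2,
      memf (final k u.1.1) == memf (final k u.1.2) &
      t <= #|[set p | differ u.2 u.1.1 u.1.2 p]|].

Definition ambiguous := [set k | [exists u, confused k u]].

(** The factors count the two families of permutations, the colouring, the two owner maps, the two
    shared views and the final contents of the shared cells. *)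
Definition advice_bound :=
  #|{: sigma}| ^ 2 * 2 ^ B * (B.+1 ^ M) ^ 2 *
  (((B * M * W).+1 ^ (2 * x)) ^ 2 * (M * W).+1 ^ (2 * x)).

(** Group the ambiguous [k] by a witness together with its owner maps and shared contents, and apply
    [fibre_bound] to each group. *)
Lemma card_ambiguous : #|ambiguous| ^ 2 * q ^ t <= (advice_bound * (W ^ M * q ^ (m * B))) ^ 2.
Proof.
pose wit k : pairs := odflt ([ffun=> 1%g], [ffun=> 1%g], [ffun=> true]) [pick u | confused k u].
have witP k : k \in ambiguous -> confused k (wit k).
  rewrite inE /wit; case: pickP => // none /existsP[u].
  by rewrite none.
pose adv k := let: (s, s', _) := wit k in
  (wit k, (owner k s, owner k s'), ((shared_view k s, shared_view k s'), shared_final k s s')).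
pose SV := [set E : {set 'I_B * 'I_M * 'I_W} | #|E| <= 2 * x].
pose SF := [set E : {set 'I_M * 'I_W} | #|E| <= 2 * x].
pose Adv := setX [set: pairs * ({ffun 'I_M -> option 'I_B} * {ffun 'I_M -> option 'I_B})]
                 (setX (setX SV SV) SF).
have cAdv : #|Adv| <= advice_bound.
  rewrite /Adv !cardsX cardsT !card_prod !card_ffun card_option card_bool !card_ord /advice_bound.
  apply: leq_mul; first by rewrite card_ffun card_ord -!mulnn.
  rewrite -[_ ^ 2]mulnn; do !apply: leq_mul.
  - apply: leq_trans (card_small_sets _ _) _; by rewrite !card_prod !card_ord.
  - apply: leq_trans (card_small_sets _ _) _; by rewrite !card_prod !card_ord.
  - apply: leq_trans (card_small_sets _ _) _; by rewrite !card_prod !card_ord.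
have advP k : k \in ambiguous -> adv k \in Adv.
  move=> /witP; rewrite /confused /adv; case: (wit k) => [[s s'] chi] /=.
  case/and4P=> /leq_shared[g1 g1'] /leq_shared[g2 g2'] _ _.
  rewrite !in_setX !inE g1' g2' /=.
  apply: leq_trans (leq_imset_card _ _) _.
  rewrite cardsU; apply: leq_trans (leq_subr _ _) _.
  by rewrite mul2n -addnn leq_add.
pose fib a := [set k in ambiguous | adv k == a].
have fibP a : #|fib a| ^ 2 * q ^ t <= (W ^ M * q ^ (m * B)) ^ 2.
  have [->|[k0]] := set_0Vmem (fib a); first by rewrite cards0.
  rewrite inE => /andP[k0A /eqP k0a]; have /and4P[_ _ _ tk] := witP _ k0A.
  pose u := wit k0.
  have wit_cst k : k \in fib a -> wit k = u.
    rewrite inE -k0a /u => /andP[_ /eqP]; rewrite /adv.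
    by case: (wit k) => [[? ?] ?]; case: (wit k0) => [[? ?] ?] [-> -> ->].
  apply: leq_trans (_ : #|fib a| ^ 2 * q ^ #|[set p | differ u.2 u.1.1 u.1.2 p]| <= _).
    by rewrite leq_mul2l leq_pexp2l // orbT.
  apply: fibre_bound => [k k' kf k'f | k kf].
    have := wit_cst _ kf; have := wit_cst _ k'f.
    move: kf k'f; rewrite !inE => /andP[_ /eqP<-] /andP[_ /eqP]; rewrite /adv.
    by move=> + ek ek'; rewrite ek ek'; case: u {ek ek' wit_cst} => [[s s'] chi] [-> -> -> -> ->].
  have := wit_cst _ kf; move: kf; rewrite inE => /andP[/witP/and4P[_ _ /eqP/memf_inj e _] _].
  by move=> <-.
pose mx := \max_a #|fib a|.
have mxP : mx ^ 2 * q ^ t <= (W ^ M * q ^ (m * B)) ^ 2.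
  rewrite /mx; elim/big_ind: _ => [|a b Ha Hb|a _]; rewrite ?exp0n //.
  by case: (leqP a b).
have le : #|ambiguous| <= advice_bound * mx.
  rewrite -(sum_card_fibre ambiguous adv) (bigID (mem Adv)) /= [X in _ + X]big1 ?addn0.
    apply: leq_trans (_ : \sum_(a in Adv) mx <= _).
      by apply: leq_sum => a _; apply: leq_bigmax.
    by rewrite sum_nat_const leq_mul2r cAdv orbT.
  move=> a aA; apply/eqP; rewrite cards_eq0; apply/eqP/setP => k; rewrite !inE.
  apply/negP => /andP[kA /eqP ea]; move: aA; rewrite -ea advP //.
  by rewrite inE.
apply: leq_trans (_ : (advice_bound * mx) ^ 2 * q ^ t <= _).
  by rewrite leq_mul2r leq_sqr le orbT.
by rewrite expnMn [leqRHS]expnMn -mulnA leq_mul2l mxP orbT.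
Qed.
Definition goods := [set ks : keys * sigma | good x ks.1 ks.2].

(** The deleted keys and the final memory determine [k]. If [k] is not ambiguous, the good
    permutations that lead to this memory have labels within distance [h] of each other, as a
    separating colouring would otherwise make [k] ambiguous. *)
Lemma card_goods :
  #|goods| <= #|ambiguous| * #|{: sigma}| + q ^ (B * m) * W ^ M * (2 ^ (m * B) * B ^ h).
Proof.
pose near := [set ks in goods | ks.1 \notin ambiguous].
have sub : goods \subset setX ambiguous [set: sigma] :|: near.
  apply/subsetP => -[k s] ksg.
  rewrite in_setU in_setX in_setT andbT [(k, s) \in near]inE ksg /=; exact: orbN.
apply: leq_trans (subset_leq_card sub) _.
rewrite cardsU; apply: leq_trans (leq_subr _ _) _; rewrite cardsX cardsT leq_add2l.
pose key (ks : keys * sigma) : {ffun 'I_B * 'I_m -> 'I_q} * {ffun 'I_M -> 'I_W} :=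
  ([ffun e => ks.1.1 (dslot e)], memf (final ks.1 ks.2)).
have cK : q ^ (B * m) * W ^ M = #|{: {ffun 'I_B * 'I_m -> 'I_q} * {ffun 'I_M -> 'I_W}}|.
  by rewrite card_prod !card_ffun card_prod !card_ord.
rewrite -(sum_card_fibre near key) cK.
apply: leq_trans (_ : \sum_(c : {ffun 'I_B * 'I_m -> 'I_q} * {ffun 'I_M -> 'I_W})
    2 ^ (m * B) * B ^ h <= _); last by rewrite sum_nat_const.
apply: leq_sum => c _; set F := [set _ in _ | _].
have [->|[[k s] F0]] := set_0Vmem F; first by rewrite cards0.
have same ks : ks \in F -> ks.1 = k /\ memf (final k ks.2) = memf (final k s).
  move: F0; rewrite !inE /= => /andP[_ /eqP <-] /andP[_ /eqP[/ffunP ed ef]].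
  have ek : ks.1 = k.
    by apply: final_inj (memf_inj ef) => e; have := ed e; rewrite !ffunE.
  by rewrite -ef ek.
have inj : {in F &, injective (fun ks => labels ks.2)}.
  move=> [k1 s1] [k2 s2] /same[/= -> _] /same[/= -> _] /labels_inj ->.
  by [].
rewrite -(card_in_imset inj).
have <- : #|{: 'I_m * 'I_B}| = m * B by rewrite card_prod !card_ord.
apply: leq_trans (card_hamming_ball h (labels s) B_gt0); apply: subset_leq_card.
apply/subsetP => _ /imsetP[[k' s'] kF ->]; rewrite inE leqNgt; apply/negP => far.
have [/= ek ef] := same _ kF.
move: F0 kF; rewrite !inE /= ek => /andP[/andP[g1 /negP nA] _] /andP[/andP[g2 _] _].
apply: nA; apply/existsP.
have [chi sep] := separating_colouring (labels s) (labels s').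
exists (s, s', chi); rewrite /confused /= g1 g2 ef eqxx /=.
have : 2 * t <= 2 * #|[set p | differ chi s s' p]|.
  apply: leq_trans th (leq_trans far (leq_trans sep _)).
  rewrite leq_mul2l /=; apply: subset_leq_card; apply/subsetP => p.
  by rewrite !inE !ffunE.
by rewrite leq_mul2l.
Qed.

(** By the second bound, good pairs with unambiguous keys make up at most a quarter of all pairs. If
    half of the pairs were good, a quarter of the keys would be ambiguous, against [card_ambiguous]
    and the third bound. *)
Lemma few_good V :
  W ^ M <= q ^ n * 2 ^ V ->
  4 * (2 ^ V * (2 ^ (m * B) * B ^ h)) <= B`! ^ m ->
  16 * (advice_bound * 2 ^ V) ^ 2 < q ^ t ->
  2 * #|goods| < q ^ (n + m * B) * B`! ^ m.
Proof.
move=> memb small big; rewrite ltnNge; apply/negP => many.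
have cS : #|{: sigma}| = B`! ^ m by rewrite card_ffun card_Sn card_ord.
have F0 : 0 < B`! ^ m by rewrite expn_gt0 fact_gt0.
have near : 4 * (q ^ (B * m) * W ^ M * (2 ^ (m * B) * B ^ h)) <= q ^ (n + m * B) * B`! ^ m.
  have := leq_mul (leq_mul (leqnn (q ^ (m * B))) memb) (leqnn (4 * (2 ^ (m * B) * B ^ h))).
  have := leq_mul (leqnn (q ^ (n + m * B))) small.
  rewrite expnD (mulnC B m); move: (q ^ n) (q ^ (m * B)) (W ^ M) (2 ^ V) (2 ^ (m * B)) (B ^ h) (B`! ^ m).
  move=> x1 x2 x3 x4 x5 x6 x7; lia.
have amb : q ^ (n + m * B) <= 4 * #|ambiguous|.
  have := card_goods; rewrite cS => le.
  rewrite -(leq_pmul2r F0); move: le many near.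
  move: (q ^ (B * m) * W ^ M * (2 ^ (m * B) * B ^ h)) (q ^ (n + m * B)) #|goods| #|ambiguous| (B`! ^ m).
  move=> x1 x2 x3 x4 x5; lia.
have := card_ambiguous; apply/negP; rewrite -ltnNge -(ltn_pmul2l (isT : 0 < 16)).
apply: (@leq_ltn_trans ((advice_bound * 2 ^ V) ^ 2 * (q ^ (n + m * B)) ^ 2 * 16)).
  rewrite mulnC leq_mul2r /= -expnMn leq_sqr expnD.
  have := leq_mul (leqnn (advice_bound * q ^ (m * B))) memb.
  by move: (q ^ n) (q ^ (m * B)) (W ^ M) (2 ^ V) => x1 x2 x3 x4; lia.
have q0 : 0 < (q ^ (n + m * B)) ^ 2 by rewrite !expn_gt0 q_gt0.
apply: (@leq_trans (q ^ t * (q ^ (n + m * B)) ^ 2)).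
  by rewrite mulnAC (mulnC _ 16) ltn_pmul2r.
rewrite mulnA mulnC leq_mul2r; apply/orP; right.
by rewrite (_ : 16 = 4 ^ 2) // -expnMn leq_sqr.
Qed.

End Counting.
End Node.

(** * Key sequences *)

Section Sequences.
Variables (U w : nat) (D : dict U w) (n : nat) (x0 : 'I_U).
Hypothesis D_correct : correct_dict D n.
Implicit Types (p : seq 'I_U).

(** A sequence [p] of [2n] keys lists the [n] keys of [K] in the order of their
    deletion, followed by the [n] keys inserted by the meta-operations. *)
Definition dseq p t := nth x0 p t.
Definition aseq p t := nth x0 p (n + t).

Definition initial p := [seq Ins x | x <- enum [set x in take n p]].
Definition block p i l := flatten [seq metaop (dseq p t) (aseq p t) | t <- iota i l].
Definition state p i := runs D (initial p ++ block p 0 i) (init D).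
Definition span p i l := accs D (block p i l) (state p i).

Lemma block_cat p i l1 l2 : block p i (l1 + l2) = block p i l1 ++ block p (i + l1) l2.
Proof. by rewrite /block iotaD map_cat flatten_cat. Qed.

Lemma state_add p i l : state p (i + l) = runs D (block p i l) (state p i).
Proof. by rewrite /state block_cat add0n catA runs_cat. Qed.

Lemma span_cat p i l1 l2 : span p i (l1 + l2) = span p i l1 :|: span p (i + l1) l2.
Proof. by rewrite /span block_cat accs_cat state_add. Qed.

Lemma span_bigcup p i l B : span p i (B * l) = \bigcup_(j < B) span p (i + j * l) l.
Proof.
elim: B => [|B IH]; first by rewrite big_ord0.
by rewrite big_ord_recr /= mulSnr span_cat IH.
Qed.

Definition contents p i : {set 'I_U} :=
  [set if t < i then aseq p t else dseq p t | t : 'I_n].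

Lemma ok_inserts m S s : ok D n m S -> uniq s -> {in s, forall x, x \notin S} ->
  #|S| + size s <= n -> ok D n (runs D [seq Ins x | x <- s] m) (S :|: [set x in s]).
Proof.
elim: s m S => [|x s IH] m S okm.
  by rewrite (_ : [set x in [::]] = set0) ?setU0 //; apply/setP=> e; rewrite !inE.
move=> /= /andP[xs us] nS sz; have xS : x \notin S by apply: nS; rewrite mem_head.
rewrite (_ : S :|: _ = (x |: S) :|: [set x in s]); last first.
  by apply/setP => y; rewrite !inE orbCA orbA.
apply: IH => //; first by apply: ok_ins => //; apply: leq_trans sz; rewrite addnS ltnS leq_addr.
  move=> y ys; rewrite !inE negb_or nS ?andbT; last by rewrite inE ys orbT.
  by apply: contraNneq xs => <-.
by rewrite cardsU1 xS add1n addSnnS.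
Qed.

Section Uniq.
Variable p : seq 'I_U.
Hypotheses (p_uniq : uniq p) (p_size : size p = 2 * n).

Lemma pos_inj i j : i < 2 * n -> j < 2 * n -> nth x0 p i = nth x0 p j -> i = j.
Proof. by rewrite -p_size => ? ? /eqP; rewrite nth_uniq // => /eqP. Qed.

Lemma card_contents i : #|contents p i| = n.
Proof.
rewrite card_imset ?card_ord // => t t'; rewrite /aseq /dseq.
have := ltn_ord t; have := ltn_ord t'.
by do 2 case: ifP => ?; move=> ? ? /pos_inj e; apply/val_inj => /=; lia.
Qed.

Lemma contents0 : contents p 0 = [set x in take n p].
Proof.
apply/setP => x; rewrite inE; apply/imsetP/(nthP x0) => [[t _ ->]|[t lt <-]].
  by exists t; rewrite ?nth_take // size_take p_size; case: ifP => _ //; have := ltn_ord t; lia.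
have tn : t < n by move: lt; rewrite size_take p_size; case: ifP; lia.
by exists (Ordinal tn); rewrite ?nth_take.
Qed.

Lemma state_ok i : i <= n -> ok D n (state p i) (contents p i).
Proof.
elim: i => [_|i IH lt].
  rewrite /state cats0 contents0 -[X in ok _ _ _ X]set_enum -[X in ok _ _ _ X]set0U.
  apply: ok_inserts; rewrite ?enum_uniq ?cards0 -?cardE //.
    by move=> x _; rewrite inE.
  by rewrite add0n -contents0 card_contents.
have okS := IH (ltnW lt); rewrite -addn1 state_add.
have dS : dseq p i \in contents p i.
  by apply/imsetP; exists (Ordinal lt) => //=; rewrite ltnn.
have aS : aseq p i \notin contents p i.
  apply/negP => /imsetP[t _]; rewrite /aseq /dseq; have := ltn_ord t.
  by case: ifP => ? ? /pos_inj; lia.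
have [] := ok_metaop okS (card_contents i) dS aS.
rewrite /block /= => okS' _; rewrite (_ : contents p _ = aseq p i |: contents p i :\ dseq p i) //.
apply/setP => x; rewrite !inE addn1; apply/imsetP/orP => [[t _ ->]|[/eqP->|/andP[xd /imsetP[t _ xt]]]].
- rewrite ltnS leq_eqVlt; have [-> | ti] /= := eqVneq (t : nat) i; first by left.
  right; apply/andP; split; last by apply/imsetP; exists t.
  apply/eqP; rewrite /aseq /dseq; have := ltn_ord t.
  by case: ifP => ? ? /pos_inj; lia.
- by exists (Ordinal lt) => //=; rewrite ltnSn.
exists t => //; rewrite xt ltnS [t <= i]leq_eqVlt; have [ti|//] /= := eqVneq (t : nat) i.
by move: xd; rewrite xt ti ltnn eqxx.
Qed.

End Uniq.

End Sequences.

Arguments state {U w} D n x0 p i.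
Arguments span {U w} D n x0 p i l.

(** * Averaging over permutations of the universe *)

Lemma perm_onto (T : finType) (s t : seq T) : uniq s -> uniq t -> size s = size t ->
  exists pi : {perm T}, map pi s = t.
Proof.
elim: s t => [|x s IH] [|y t] //=; first by exists 1%g.
move=> /andP[xs us] /andP[yt ut] [/(IH _ us ut)[pi e]].
exists (pi * tperm (pi x) y)%g; rewrite permM tpermL; congr (_ :: _).
rewrite -e; apply/eq_in_map => z zs; rewrite permM tpermD //.
  by apply: contraNneq xs => /perm_inj ->.
by apply: contraNneq yt => ->; rewrite -e map_f.
Qed.

(** A fixed injective tuple moved by a random permutation is a random injective tuple; denominators
    are cleared to stay in [nat]. *)
Lemma sum_perm_tuple (T : finType) (N : nat) (F : seq T -> nat) (x : seq T) :
  uniq x -> size x = N ->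
  #|[set p : N.-tuple T | uniq p]| * \sum_(pi : {perm T}) F (map pi x) =
  #|{perm T}| * \sum_(p : N.-tuple T | uniq p) F p.
Proof.
move=> ux sx; have inv (p : N.-tuple T) : uniq p ->
    \sum_(pi : {perm T}) F (map pi x) = \sum_(pi : {perm T}) F (map pi p).
  move=> up; have [|rho <-] := perm_onto ux up; first by rewrite size_tuple.
  rewrite (reindex_inj (mulgI rho)) /=; apply: eq_bigr => pi _; congr F.
  by rewrite -map_comp; apply: eq_map => z; rewrite permM.
rewrite -sum1_card big_distrl /= (eq_bigl (fun p : N.-tuple T => uniq p)); last first.
  by move=> p; rewrite inE.
rewrite (eq_bigr (fun p : N.-tuple T => \sum_(pi : {perm T}) F (map pi p))); last first.
  by move=> p up; rewrite mul1n (inv p up).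
rewrite exchange_big /= (eq_bigr (fun=> \sum_(p : N.-tuple T | uniq p) F p)).
  by rewrite sum_nat_const.
move=> pi _; rewrite [RHS](reindex (fun p : N.-tuple T => map_tuple pi p)) /=.
  by apply: eq_bigl => p; rewrite map_inj_uniq //; apply: perm_inj.
exists (fun p : N.-tuple T => map_tuple (pi^-1)%g p) => p _; apply: val_inj => /=;
  rewrite -map_comp -[RHS]map_id; apply: eq_map => z /=; by rewrite ?permK ?permKV.
Qed.

(** * Embedding a node into the universe *)

Section Embedding.
Variables (U w : nat) (D : dict U w) (n : nat) (x0 : 'I_U).
Hypothesis D_correct : correct_dict D n.
Variables (i m B q : nat).
Hypotheses (n_gt0 : 0 < n) (q_gt0 : 0 < q) (B_gt0 : 0 < B)
  (qU : 3 * n * q <= U) (iBm : i + B * m <= n).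

Local Notation keys := ({ffun 'I_n -> 'I_q} * {ffun 'I_m * 'I_B -> 'I_q})%type.
Local Notation sigma := {ffun 'I_m -> 'S_B}.

(** The last summand provides filler keys for the deletions before time [i] and for the later
    insertions outside the node. *)
Definition slots : finType := ('I_n * 'I_q + ('I_m * 'I_B * 'I_q + 'I_n))%type.

Lemma leq_card_slots : #|slots| <= U.
Proof.
rewrite !card_sum !card_prod !card_ord; apply: leq_trans qU.
have : m * B <= n by rewrite mulnC; apply: leq_trans iBm; apply: leq_addl.
move=> /(leq_mul (leqnn q)); have := leq_mul q_gt0 (leqnn n); lia.
Qed.

Definition place (z : slots) : 'I_U := widen_ord leq_card_slots (enum_rank z).

Lemma place_inj : injective place.
Proof. by move=> z z' /(congr1 val) /= e; apply/enum_rank_inj/val_inj. Qed.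

Lemma ltn_dslot (e : 'I_B * 'I_m) : i + e.1 * m + e.2 < n.
Proof.
case: e => [[j jB] [l lm]] /=; apply: leq_trans iBm; rewrite -addnA -addnS leq_add2l.
by apply: leq_trans (_ : j.+1 * m <= _); [rewrite mulSnr -addnS leq_add2l | rewrite leq_mul2r jB orbT].
Qed.

Definition dslot e := Ordinal (ltn_dslot e).

Lemma dslot_inj : injective dslot.
Proof.
move=> [j l] [j' l'] /(congr1 val) /= /eqP; rewrite -!addnA eqn_add2l => /eqP e.
have m0 : 0 < m by apply: leq_ltn_trans (ltn_ord l).
have := congr1 (divn^~ m) e; have := congr1 (modn^~ m) e.
rewrite !modnMDl !divnMDl // !modn_small ?divn_small ?ltn_ord // !addn0.
by move=> /val_inj -> /val_inj ->.
Qed.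

Section Perm.
Variable pi : 'S_U.

Definition key0 t v := pi (place (inl (t, v))).
Definition keyA p v := pi (place (inr (inl (p, v)))).

(** Slot [t] must hold [k.1 t] at time [i]: for [t < i] this key is inserted by meta-operation [t],
    otherwise it is an initial key. *)
Definition dplace (k : keys) (t : 'I_n) : slots :=
  if t < i then inr (inr t) else inl (t, k.1 t).
Definition aplace (k : keys) (s : sigma) (t : 'I_n) : slots :=
  if t < i then inl (t, k.1 t)
  else if [pick e | dslot e == t] is Some e then inr (inl (aslot s e, k.2 (aslot s e)))
  else inr (inr t).
Definition places k s := map (dplace k) (enum 'I_n) ++ map (aplace k s) (enum 'I_n).

Lemma places_uniq k s : uniq (places k s).
Proof.
rewrite cat_uniq; apply/and3P; split.
- rewrite map_inj_uniq ?enum_uniq // => t t'; rewrite /dplace.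
  by case: ifP => ti; case: ifP => ti' // [].
- apply/hasPn => _ /mapP[t _ ->]; apply/negP => /mapP[t' _]; rewrite /aplace /dplace.
  case: ifP => ti; case: ifP => ti' //.
  + by case=> e; rewrite -e ti in ti'.
  + by case: pickP => // _ [e]; rewrite e ti' in ti.
  by case: pickP.
rewrite map_inj_uniq ?enum_uniq // => t t'.
rewrite /aplace; case: ifP => ti; case: ifP => ti'; first by case.
+ by case: pickP.
+ by case: pickP.
case: pickP => [e /eqP <-|_]; case: pickP => [e' /eqP <-|_] //.
  case=> e2 e1 _; congr dslot; apply: (@aslot_inj B m s).
  by rewrite /aslot e1 e2.
by case.
Qed.

Lemma size_places k s : size (places k s) = 2 * n.
Proof. by rewrite size_cat 2!size_map size_enum_ord mul2n addnn. Qed.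

Definition order k s := map (fun z => pi (place z)) (places k s).

Lemma order_uniq k s : uniq (order k s).
Proof. by rewrite map_inj_uniq ?places_uniq // => z z' /perm_inj/place_inj. Qed.

Lemma size_order k s : size (order k s) = 2 * n.
Proof. by rewrite size_map size_places. Qed.

Lemma dseq_order k s (t : 'I_n) : dseq x0 (order k s) t = pi (place (dplace k t)).
Proof.
rewrite /dseq /order map_cat nth_cat 2!size_map size_enum_ord ltn_ord -map_comp.
by rewrite (nth_map t) ?size_enum_ord // nth_ord_enum.
Qed.

Lemma aseq_order k s (t : 'I_n) : aseq n x0 (order k s) t = pi (place (aplace k s t)).
Proof.
rewrite /aseq /order map_cat nth_cat 2!size_map size_enum_ord ltnNge leq_addr /= addKn.
by rewrite -map_comp (nth_map t) ?size_enum_ord // nth_ord_enum.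
Qed.

Definition key_default : {ffun 'I_m * 'I_B -> 'I_q} := [ffun=> Ordinal q_gt0].

(** Up to time [i] the permutations and the keys inserted by the node have no influence, so default
    values do; [state_order] proves it. *)
Definition M0 f := state D n x0 (order (f, key_default) [ffun=> 1%g]) i.

Lemma state_order k s : state D n x0 (order k s) i = M0 k.1.
Proof.
rewrite /M0 /state; congr runs; congr (_ ++ _).
  have tk k' s' : take n (order k' s') =
      [seq pi (place z) | z <- [seq dplace k' t | t <- enum 'I_n]].
    by rewrite /order map_cat take_size_cat // 2!size_map size_enum_ord.
  by rewrite /initial !tk.
congr flatten; apply/eq_in_map => t; rewrite mem_iota add0n => /andP[_ ti].
have tn : t < n by lia.
rewrite -[t]/(val (Ordinal tn)) !dseq_order !aseq_order /dplace /aplace /=.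
by rewrite ti.
Qed.

Lemma M0_ok f : ok D n (M0 f) [set key0 t (f t) | t : 'I_n].
Proof.
pose p := order (f, key_default) [ffun=> 1%g].
have -> : [set key0 t (f t) | t : 'I_n] = contents n x0 p i.
  apply: eq_imset => t; rewrite dseq_order aseq_order /dplace /aplace.
  by case: (t < i).
apply: state_ok => //; [exact: order_uniq | exact: size_order | lia].
Qed.

Lemma key0_inj t v t' v' : key0 t v = key0 t' v' -> t = t' /\ v = v'.
Proof. by move=> /perm_inj/place_inj[-> ->]. Qed.

Lemma keyA_inj p v p' v' : keyA p v = keyA p' v' -> p = p' /\ v = v'.
Proof. by move=> /perm_inj/place_inj[-> ->]. Qed.

Lemma key0A t v p v' : key0 t v <> keyA p v'.
Proof. by move=> /perm_inj/place_inj. Qed.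

Lemma child_order k s j :
  child key0 keyA dslot k s j = block n x0 (order k s) (i + j * m) m.
Proof.
rewrite /child /metas /block /child_list; congr flatten.
rewrite -map_comp -[i + j * m]addn0 iotaDl -val_enum_ord -!map_comp.
apply: eq_map => l /=.
rewrite -[i + j * m + l]/(val (dslot (j, l))) dseq_order aseq_order.
have nlt : (dslot (j, l) < i) = false by rewrite /= ltnNge -addnA leq_addr.
rewrite /dplace /aplace nlt /dkey /akey; case: pickP => [e /eqP/dslot_inj -> //|].
by move=> /(_ (j, l)); rewrite eqxx.
Qed.

Lemma mems_order k s j : j <= B ->
  mems key0 keyA dslot M0 k s j = state D n x0 (order k s) (i + j * m).
Proof.
elim: j => [_|j IH lt]; first by rewrite /= addn0 state_order.
rewrite mulSnr addnA state_add -IH ?(ltnW lt) //.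
by rewrite (memsS _ _ _ _ k s (Ordinal lt)) child_order.
Qed.

Lemma touched_order k s j :
  touched key0 keyA dslot M0 k s j = span D n x0 (order k s) (i + j * m) m.
Proof. by rewrite /touched child_order mems_order // ltnW. Qed.

End Perm.

(** Counts, for each cell, the children that touch it beyond the first one. *)
Definition spread (p : seq 'I_U) : nat :=
  (\sum_(j < B) #|span D n x0 p (i + j * m) m|) - #|span D n x0 p i (B * m)|.

Lemma good_spread pi x k s : ~~ good (key0 pi) (keyA pi) dslot (M0 pi) x k s ->
  x < spread (order pi k s).
Proof.
rewrite /good -ltnNge /spread span_bigcup.
have -> : \bigcup_j touched (key0 pi) (keyA pi) dslot (M0 pi) k s j =
    \bigcup_(j < B) span D n x0 (order pi k s) (i + j * m) m.
  by apply: eq_bigr => j _; rewrite touched_order.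
under eq_bigr do rewrite touched_order.
by rewrite ltn_subRL.
Qed.

(** For each permutation of the universe, more than half of the pairs are not good and thus have
    spread above [x]; averaging over these permutations gives random key sequences. *)
Lemma spread_average x h t V :
  2 * t <= h.+1 -> (2 ^ w) ^ cells D <= q ^ n * 2 ^ V ->
  4 * (2 ^ V * (2 ^ (m * B) * B ^ h)) <= B`! ^ m ->
  16 * (advice_bound D B m x * 2 ^ V) ^ 2 < q ^ t ->
  x.+1 * #|[set p : (2 * n).-tuple 'I_U | uniq p]| <=
    2 * \sum_(p : (2 * n).-tuple 'I_U | uniq p) spread p.
Proof.
move=> th memb small big.
set total := q ^ (n + m * B) * B`! ^ m.
have cT : #|{: keys * sigma}| = total.
  by rewrite !card_prod !card_ffun card_prod !card_ord -expnD card_Sn.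
have one pi : x.+1 * total <= 2 * \sum_(ks : keys * sigma) spread (order pi ks.1 ks.2).
  have few := few_good (@key0_inj pi) (@keyA_inj pi) (@key0A pi) dslot_inj (@M0_ok pi)
    q_gt0 B_gt0 th memb small big.
  set G := goods _ _ _ _ _ in few.
  rewrite (bigID (mem G)) /=.
  apply: leq_trans (_ : 2 * ((total - #|G|) * x.+1) <= _).
    rewrite mulnA mulnC leq_mul2r; apply/orP; right; move: few; rewrite -/total.
    by clear; move: #|_| total => c c'; lia.
  rewrite leq_mul2l /=; apply: leq_trans (leq_addl _ _).
  rewrite -cT -(cardsC G) addKn -sum_nat_const.
  rewrite (eq_bigl (fun ks => ks \notin G)); last by move=> ks; rewrite inE.
  by apply: leq_sum => ks; rewrite inE; apply: good_spread.
have P0 : 0 < #|{perm 'I_U}| by apply/card_gt0P; exists 1%g.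
have T0 : 0 < total by rewrite muln_gt0 !expn_gt0 q_gt0 fact_gt0.
set Om := #|_|; set S := \sum_(_ | _) _.
have avg_pi ks : Om * \sum_(pi : 'S_U) spread (order pi ks.1 ks.2) = #|{perm 'I_U}| * S.
  rewrite -(@sum_perm_tuple _ (2 * n) spread (map place (places ks.1 ks.2))).
  - congr (_ * _); apply: eq_bigr => pi _; congr spread; by rewrite -map_comp.
  - by rewrite map_inj_uniq ?places_uniq //; apply: place_inj.
  - by rewrite size_map size_places.
rewrite -(leq_pmul2r T0) -(leq_pmul2r P0).
apply: (@leq_trans (2 * \sum_(ks : keys * sigma) #|{perm 'I_U}| * S)); last first.
  have mulE a b c : 2 * (a * (b * c)) = 2 * c * a * b by lia.
  by rewrite sum_nat_const cT mulE.
rewrite -(eq_bigr _ (fun ks _ => avg_pi ks)) -big_distrr exchange_big /=.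
rewrite mulnCA; apply: leq_trans (_ : Om * \sum_(pi : 'S_U) (x.+1 * total) <= _).
  have mulE a b c d : b * (a * (d * c)) = d * b * c * a by lia.
  by rewrite sum_nat_const mulE.
rewrite leq_mul2l; apply/orP; right; rewrite big_distrr; apply: leq_sum => pi _.
exact: one.
Qed.

End Embedding.

(** * The expected number of probes *)

Section InjectiveSequences.
Variable T : finType.
Implicit Types (A : {set T}) (F : seq T -> nat).

(** The recursion follows the successive random choices of [meta]; [nsumE] gives the flat form. *)
Fixpoint nsum i A F : nat :=
  if i is i'.+1 then \sum_(x in A) nsum i' (A :\ x) (fun s => F (x :: s)) else F [::].

Lemma sum_tuple_cons N (P : pred (seq T)) F :
  \sum_(p : N.+1.-tuple T | P p) F p =
  \sum_(x : T) \sum_(p : N.-tuple T | P (x :: p)) F (x :: p).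
Proof.
rewrite pair_big_dep /= (reindex (fun xp : T * N.-tuple T => cons_tuple xp.1 xp.2)) //=.
exists (fun p : N.+1.-tuple T => (thead p, behead_tuple p)).
  by move=> [x p] _; rewrite theadE; congr pair; apply: val_inj.
by move=> p _; rewrite [RHS]tuple_eta; apply: val_inj.
Qed.

Lemma nsumE i A F :
  nsum i A F = \sum_(p : i.-tuple T | uniq p && ([set x in p] \subset A)) F p.
Proof.
elim: i A F => [|i IH] A F /=.
  rewrite (big_pred1 [tuple]) // => p; rewrite [p]tuple0; apply: (etrans _ (esym (eqxx _))).
  by apply/subsetP => x; rewrite inE.
rewrite (sum_tuple_cons i (fun p => uniq p && ([set x in p] \subset A))) big_mkcond.
apply: eq_bigr => x _; rewrite IH; case: ifP => xA.
  apply: eq_bigl => p /=; rewrite -andbA; apply/idP/idP.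
    case/andP=> up /subsetP sA; rewrite up /=; apply/andP; split.
      by apply/negP => xp; have := sA x; rewrite !inE xp eqxx /= => /(_ isT).
    apply/subsetP => y; rewrite !inE => /predU1P[-> // | yp].
    by have := sA y; rewrite !inE yp => /(_ isT)/andP[].
  case/and3P=> xp up /subsetP sA; rewrite up; apply/subsetP => y; rewrite !inE => yp.
  rewrite sA ?inE ?yp ?orbT // andbT; by apply: contraNneq xp => <-.
rewrite big_pred0 // => p; apply/negP => /andP[_ /subsetP/(_ x)].
by rewrite !inE eqxx xA => /(_ isT).
Qed.

Lemma eq_nsum i A F G : (forall s, F s = G s) -> nsum i A F = nsum i A G.
Proof.
by elim: i A F G => [|i IH] A F G e /=; rewrite ?e //; apply: eq_bigr => x _; apply: IH.
Qed.

Lemma nsum_const i A c : nsum i A (fun=> c) = #|A| ^_ i * c.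
Proof.
elim: i A => [|i IH] A /=; first by rewrite mul1n.
rewrite (eq_bigr (fun=> #|A|.-1 ^_ i * c)).
  by rewrite sum_nat_const mulnA -ffactnS.
by move=> x xA; rewrite IH (cardsD1 x A) xA.
Qed.

Lemma nsum_add i A F G : nsum i A (fun s => F s + G s) = nsum i A F + nsum i A G.
Proof.
by elim: i A F G => [|i IH] A F G //=; rewrite -big_split; apply: eq_bigr => x _; apply: IH.
Qed.

Lemma nsum_sum (I : finType) (B : {set I}) i A (F : I -> seq T -> nat) :
  nsum i A (fun s => \sum_(x in B) F x s) = \sum_(x in B) nsum i A (F x).
Proof.
elim: i A F => [|i IH] A F //=.
by rewrite exchange_big /=; apply: eq_bigr => y _; apply: IH.
Qed.

Lemma nsum_cat i j A F :
  nsum (i + j) A F =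
  nsum i A (fun s => nsum j (A :\: [set x in s]) (fun s' => F (s ++ s'))).
Proof.
elim: i A F => [|i IH] A F /=.
  by congr nsum; apply/setP => x; rewrite !inE.
apply: eq_bigr => x _; rewrite IH; apply: eq_nsum => s; congr nsum.
by apply/setP => y; rewrite !inE negb_or; case: (y == x); rewrite /= ?andbF.
Qed.

(** An injective sequence of [2 * n] keys amounts to a set [K], an order on it and an injective
    sequence outside [K], as in the hard distribution. *)
Lemma sum_sets_nsum n F :
  \sum_(K in [set K : {set T} | #|K| == n])
    nsum n K (fun ds => nsum n (~: K) (fun xs => F (ds ++ xs))) =
  \sum_(p : (2 * n).-tuple T | uniq p) F p.
Proof.
have -> : \sum_(p : (2 * n).-tuple T | uniq p) F p = nsum (2 * n) setT F.
  by rewrite nsumE; apply: eq_bigl => p; rewrite subsetT andbT.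
rewrite mul2n -addnn nsum_cat nsumE.
rewrite (partition_big (fun p : n.-tuple T => [set x in p]) (mem [set K : {set T} | #|K| == n])).
  apply: eq_bigr => K; rewrite inE => /eqP cK; rewrite nsumE.
  transitivity (\sum_(p : n.-tuple T | uniq p && ([set x in p] \subset setT) &&
       ([set x in p] == K)) nsum n (~: K) (fun xs => F (p ++ xs))).
    apply: eq_bigl => p; rewrite subsetT andbT; case: (boolP (uniq p)) => //= up.
    by rewrite eqEcard cK cardsE (card_uniqP up) size_tuple leqnn andbT.
  by apply: eq_bigr => p /andP[_ /eqP ep]; rewrite setTD ep.
move=> p /andP[up _]; rewrite /= inE; apply/eqP; rewrite cardsE.
by rewrite (card_uniqP up) size_tuple.
Qed.

End InjectiveSequences.

Section Average.
Local Open Scope R_scope.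

Lemma INR_sum (T : finType) (A : {set T}) (f : T -> nat) :
  INR (\sum_(x in A) f x) = \big[Rplus/R0]_(x in A) INR (f x).
Proof. by rewrite (big_morph INR plus_INR (erefl _ : INR 0 = R0)). Qed.

Lemma avg_INR (T : finType) (A : {set T}) (f : T -> R) (g : T -> nat) (k : nat) :
  (0 < #|A|)%N -> {in A, forall x, f x * INR k = INR (g x)} ->
  avg A f * INR (#|A| * k) = INR (\sum_(x in A) g x).
Proof.
move=> A0 fg; rewrite INR_sum -(eq_bigr _ fg).
rewrite -(big_morph (fun x => x * INR k) (fun x y => Rmult_plus_distr_r x y _) (Rmult_0_l _ : R0 * INR k = R0)).
rewrite mult_INR /avg; field; apply: not_0_INR; lia.
Qed.

End Average.

Lemma eq_in_nsum (T : finType) i (A : {set T}) F G :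
  (forall s, uniq s -> size s = i -> [set x in s] \subset A -> F s = G s) ->
  nsum i A F = nsum i A G.
Proof.
move=> e; rewrite !nsumE; apply: eq_bigr => p /andP[up sA].
by apply: e => //; rewrite size_tuple.
Qed.

Section Expectation.
Variables (U w : nat) (D : dict U w).
Local Notation M := (cells D).
Local Notation W := (2 ^ w).

Lemma stepE o m : @step U w D o m = (post (alg D o) m, probes (alg D o) m).
Proof. by rewrite /step runE. Qed.

Lemma ins_allE m s : @ins_all U w D m s =
  (runs D [seq Ins x | x <- s] m, costs D [seq Ins x | x <- s] m).
Proof. by elim: s m => //= x s IH m; rewrite stepE IH. Qed.

Lemma costs_cat s1 s2 m : costs D (s1 ++ s2) m = costs D s1 m + costs D s2 (runs D s1 m).
Proof. by elim: s1 m => //= o s1 IH m; rewrite IH addnA. Qed.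

Definition metaops (ds xs : seq 'I_U) := flatten [seq metaop z.1 z.2 | z <- zip ds xs].

(** All sequences of choices are equally likely, since the number of candidates at each stage does
    not depend on the earlier choices. *)
Lemma meta_nsum i m (K Krem S : {set 'I_U}) :
  Krem \subset K -> #|Krem| = i -> i <= #|~: (K :|: S)| ->
  Rmult (@meta U w D K i m Krem S) (INR (i ^_ i * #|~: (K :|: S)| ^_ i)) =
  INR (nsum i Krem (fun ds => nsum i (~: (K :|: S)) (fun xs => costs D (metaops ds xs) m))).
Proof.
elim: i m Krem S => [|i IH] m Krem S sK cK iC; first by rewrite /= Rmult_0_l.
set C := ~: (K :|: S) in iC *.
pose cost d a := costs D (metaop d a) m.
pose after d a := runs D (metaop d a) m.
pose k := i ^_ i * #|C|.-1 ^_ i.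
pose g d a := cost d a * k + nsum i (Krem :\ d) (fun ds =>
  nsum i (C :\ a) (fun xs => costs D (metaops ds xs) (after d a))).
have -> : i.+1 ^_ i.+1 * #|C| ^_ i.+1 = #|Krem| * (#|C| * k).
  by rewrite cK ffactSS ffactnS /k; lia.
have -> : nsum i.+1 Krem (fun ds => nsum i.+1 C (fun xs => costs D (metaops ds xs) m)) =
    \sum_(d in Krem) \sum_(a in C) g d a.
  apply: eq_bigr => d dK; transitivity (nsum i (Krem :\ d) (fun ds =>
    \sum_(a in C) nsum i (C :\ a) (fun xs => costs D (metaops (d :: ds) (a :: xs)) m))) => //.
  rewrite nsum_sum; apply: eq_bigr => a aC.
  rewrite (_ : g d a = nsum i (Krem :\ d) (fun ds => nsum i (C :\ a) (fun xs =>
    cost d a + costs D (metaops ds xs) (after d a)))).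
    by apply: eq_nsum => ds; apply: eq_nsum => xs; rewrite -costs_cat.
  rewrite /g (_ : cost d a * k = nsum i (Krem :\ d) (fun=> nsum i (C :\ a) (fun=> cost d a))).
    by rewrite -nsum_add; apply: eq_nsum => ds; rewrite -nsum_add.
  rewrite !nsum_const.
  have -> : #|C :\ a| = #|C|.-1 by rewrite (cardsD1 a C) aC.
  have -> : #|Krem :\ d| = i by move: cK; rewrite (cardsD1 d Krem) dK => -[].
  by rewrite /k mulnC mulnA.
apply: avg_INR; first by rewrite cK.
move=> d dK; rewrite !stepE.
(* Deleting [d] frees no key for insertion, because [d] belongs to [K]. *)
have eC : ~: (K :|: S :\ d) = C.
  apply/setP => y; rewrite !inE; case: eqP => // ->.
  by rewrite (subsetP sK _ dK).
cbv zeta; rewrite eC; apply: avg_INR; first by apply: leq_trans iC.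
move=> a aC; rewrite stepE /= Rmult_plus_distr_r -mult_INR /g plus_INR; congr Rplus.
  by rewrite /cost /= addn0 addnA.
have eC' : ~: (K :|: (a |: S :\ d)) = C :\ a.
  by rewrite -eC; apply/setP => y; rewrite !inE; case: (y == a); rewrite /= ?orbT.
have cC : #|C :\ a| = #|C|.-1 by rewrite (cardsD1 a C) aC.
rewrite /k -cC -eC'; apply: IH.
- by apply: subset_trans sK; apply: subsetDl.
- by move: cK; rewrite (cardsD1 d Krem) dK => -[].
by rewrite eC' cC; lia.
Qed.

Variables (n : nat) (x0 : 'I_U).

Definition total_cost (p : seq 'I_U) :=
  costs D (initial n p ++ metaops (take n p) (drop n p)) (init D).

Lemma expected_probesE : 2 * n <= U ->
  Rmult (expected_probes D n) (INR #|[set p : (2 * n).-tuple 'I_U | uniq p]|) =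
  INR (\sum_(p : (2 * n).-tuple 'I_U | uniq p) total_cost p).
Proof.
move=> nU; pose k := n ^_ n * (U - n) ^_ n.
have cC (K : {set 'I_U}) : #|K| = n -> #|~: K| = U - n.
  by move=> cK; rewrite cardsCs setCK card_ord cK.
have -> : #|[set p : (2 * n).-tuple 'I_U | uniq p]| =
    #|[set K : {set 'I_U} | #|K| == n]| * k.
  rewrite -sum1_card (eq_bigl (fun p : (2 * n).-tuple 'I_U => uniq p)); last first.
    by move=> p; rewrite inE.
  rewrite -(sum_sets_nsum n (fun=> 1)) -sum_nat_const.
  apply: eq_bigr => K; rewrite inE => /eqP cK.
  by rewrite !nsum_const (cC _ cK) cK muln1.
rewrite -sum_sets_nsum; apply: avg_INR.
  by rewrite card_draws card_ord bin_gt0; lia.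
move=> K; rewrite inE => /eqP cK; rewrite ins_allE Rmult_plus_distr_r.
have {2}-> : k = n ^_ n * #|~: (K :|: K)| ^_ n by rewrite setUid cC.
rewrite meta_nsum //; last by rewrite setUid cC //; lia.
rewrite -mult_INR -plus_INR multE plusE setUid; congr INR.
set c0 := costs _ _ _; set m1 := runs _ _ _.
have -> : c0 * k = nsum n K (fun=> nsum n (~: K) (fun=> c0)).
  by rewrite !nsum_const cK cC // /k; lia.
rewrite -nsum_add; apply: eq_in_nsum => ds uds sds sK.
rewrite -nsum_add; apply: eq_in_nsum => xs uxs sxs _.
rewrite /total_cost /initial take_size_cat // drop_size_cat // costs_cat.
suff -> : [set x in ds] = K by [].
by apply/eqP; rewrite eqEcard sK cK cardsE (card_uniqP uds) sds leqnn.
Qed.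

Lemma metaops_block p : size p = 2 * n -> metaops (take n p) (drop n p) = block n x0 p 0 n.
Proof.
move=> sp; congr flatten.
have st : size (take n p) = n by rewrite size_take sp; case: ifP; lia.
have sd : size (drop n p) = n by rewrite size_drop sp; lia.
apply: (@eq_from_nth _ [::]); first by rewrite !size_map size_zip st sd size_iota minnn.
move=> t; rewrite size_map size_zip st sd minnn => tn.
rewrite (nth_map (x0, x0)) ?size_zip ?st ?sd ?minnn // nth_zip ?st ?sd //=.
by rewrite (nth_map 0) ?size_iota // nth_iota // nth_take // nth_drop.
Qed.

Lemma leq_span_cost p s c : size p = 2 * n -> c * s <= n ->
  \sum_(j < c) #|span D n x0 p (j * s) s| <= total_cost p.
Proof.
move=> sp cs; rewrite /total_cost metaops_block //.
have -> : block n x0 p 0 n = block n x0 p 0 (c * s) ++ block n x0 p (c * s) (n - c * s).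
  by have := block_cat n x0 p 0 (c * s) (n - c * s); rewrite subnKC.
have : \sum_(j < c) #|span D n x0 p (j * s) s| <=
    costs D (block n x0 p 0 (c * s)) (state D n x0 p 0).
  elim: c {cs} => [|c IH]; first by rewrite big_ord0.
  rewrite big_ord_recr /= mulSnr block_cat costs_cat -state_add add0n.
  by apply: leq_add IH _; apply: leq_accs_costs.
have -> : state D n x0 p 0 = runs D (initial n p) (init D) by rewrite /state cats0.
move=> le; rewrite 2!costs_cat; apply: leq_trans le _.
by rewrite addnCA leq_addr.
Qed.

End Expectation.

(** * The levels of the tree *)

Lemma sum_ord_mul (c B : nat) (F : nat -> nat) :
  \sum_(j < c * B) F j = \sum_(l < c) \sum_(j < B) F (l * B + j).
Proof.
elim: c => [|c IH]; first by rewrite !big_ord0.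
by rewrite mulSnr big_split_ord big_ord_recr /= -IH.
Qed.

Lemma leq_fact_expn n : n`! <= n ^ n.
Proof.
elim: n => // n IH; rewrite factS expnS leq_mul //; apply: leq_trans IH _.
by case: n => // n; rewrite leq_exp2r.
Qed.

Lemma expn2M a b : (2 ^ a) ^ b = 2 ^ (a * b).
Proof. by rewrite -expnM. Qed.

Section Levels.
Variables (U w : nat) (D : dict U w) (n : nat) (x0 : 'I_U).
Hypothesis D_correct : correct_dict D n.
Variables (q V : nat).
Hypotheses (n_gt0 : 0 < n) (q_gt0 : 0 < q) (qU : 3 * n * q <= U).
Hypothesis memory_bound : (2 ^ w) ^ cells D <= q ^ n * 2 ^ V.

Local Notation Om := #|[set p : (2 * n).-tuple 'I_U | uniq p]|.

Definition level s c :=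
  \sum_(p : (2 * n).-tuple 'I_U | uniq p) \sum_(j < c) #|span D n x0 p (j * s) s|.

(** Passing from [c] blocks to their [c * B] children adds exactly the spreads of the [c] nodes,
    each at least [x.+1 / 2] on average. *)
Lemma level_gain m B c x h t :
  0 < B -> c * (B * m) <= n ->
  2 * t <= h.+1 ->
  4 * (2 ^ V * (2 ^ (m * B) * B ^ h)) <= B`! ^ m ->
  16 * (advice_bound D B m x * 2 ^ V) ^ 2 < q ^ t ->
  2 * level (B * m) c + c * (x.+1 * Om) <= 2 * level m (c * B).
Proof.
move=> B0 cn th small big.
have gain (l : 'I_c) : x.+1 * Om <= 2 * \sum_(p : (2 * n).-tuple 'I_U | uniq p)
    spread D n x0 (l * (B * m)) m B p.
  apply: (spread_average x0 D_correct n_gt0 q_gt0 B0 qU _ th memory_bound small big).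
  by rewrite -mulSnr; apply: leq_trans cn; rewrite leq_mul2r ltn_ord orbT.
have split (p : (2 * n).-tuple 'I_U) :
    \sum_(j < c * B) #|span D n x0 p (j * m) m| =
    \sum_(l < c) (spread D n x0 (l * (B * m)) m B p +
                  #|span D n x0 p (l * (B * m)) (B * m)|).
  rewrite (sum_ord_mul c B (fun j => #|span D n x0 p (j * m) m|)).
  (* The truncated subtraction in [spread] is exact, a union being no larger than the sum of its
     parts. *)
  apply: eq_bigr => l _; rewrite /spread subnK; last first.
    rewrite span_bigcup; apply: (big_ind2 (fun (A : {set _}) s => #|A| <= s)) => //.
      by rewrite cards0.
    move=> A s A' s' le le'; apply: leq_trans (leq_add le le').
    by rewrite cardsU leq_subr.
  by apply: eq_bigr => j _; rewrite mulnDl -mulnA.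
rewrite /level [in X in _ <= X](eq_bigr _ (fun p _ => split p)).
under [in X in _ <= X]eq_bigr do rewrite big_split /=.
rewrite big_split /= mulnDr addnC leq_add2r exchange_big big_distrr /=.
rewrite -[X in X * _]card_ord -sum_nat_const; apply: leq_sum => l _; exact: gain.
Qed.

Variables (e b f lam x : nat).
Hypotheses (b1 : 1 < b) (fbe : f + b <= e) (en : 2 ^ e <= n) (bw : b <= w)
  (nw : 2 * n < 2 ^ w) (Mn : cells D <= 2 * n) (qlam : 2 ^ lam <= q)
  (lam0 : 0 < lam).
(** Depth [f] has [2 ^ f] nodes of [N] meta-operations, each with [2 ^ b] children. *)
Let N := 2 ^ (e - f).
Hypotheses (HV : 2 * (V + 3 * N + 2) <= b * N) (Hb : 400 * (b * n) <= lam * N)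
  (Hx : 400 * (w * x) <= lam * N).

Lemma N_split : N = 2 ^ b * 2 ^ (e - (f + b)).
Proof. by rewrite /N -expnD; congr expn; lia. Qed.

Lemma N_quarter : 4 * (N %/ 4) = N.
Proof.
rewrite mulnC divnK // N_split; apply: dvdn_mulr.
by rewrite (_ : 4 = 2 ^ 2) // dvdn_exp2l.
Qed.

Lemma leq_Nn : N <= n.
Proof. by apply: leq_trans en; rewrite leq_pexp2l // leq_subr. Qed.

Lemma N_gt0 : 0 < N. Proof. by rewrite expn_gt0. Qed.

(** A Hamming radius of [N / 2] costs [b * N / 2] of the roughly [b * N] bits in the permutations;
    by [HV] the other half covers the waste and [3 * N] bits, of which [N] choose the positions and
    [2 * N] come from the factorial bound. *)
Lemma small_bound : 4 * (2 ^ V * (2 ^ (2 ^ (e - (f + b)) * 2 ^ b) * (2 ^ b) ^ (2 * (N %/ 4))))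
  <= (2 ^ b)`! ^ (2 ^ (e - (f + b))).
Proof.
set m := 2 ^ (e - (f + b)); set B := 2 ^ b.
have eN : m * B = N by rewrite N_split mulnC.
have : (B ^ B) ^ m <= (4 ^ B * B`!) ^ m by rewrite leq_exp2r ?expn_gt0 // expn_self_leq_fact.
rewrite expnMn -!expnM (mulnC B m) eN => le.
have p4 : 0 < 4 ^ N by rewrite expn_gt0.
rewrite -(leq_pmul2l p4); apply: leq_trans le.
have e4 : 4 ^ N = 2 ^ (2 * N) by rewrite expnM.
have e4' a : 4 * 2 ^ a = 2 ^ (2 + a) by rewrite expnD.
rewrite e4 -!expnD e4' -expnD leq_pexp2l //.
have bN : b * N = 4 * (b * (N %/ 4)) by rewrite mulnCA N_quarter.
by move: HV; rewrite [b * (2 * _)]mulnCA bN; lia.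
Qed.

Lemma advice_leq : advice_bound D (2 ^ b) (2 ^ (e - (f + b))) x <=
  2 ^ (11 * (b * n) + 16 * (w * x)).
Proof.
set m := 2 ^ (e - (f + b)); set B := 2 ^ b.
have eN : B * m = N by rewrite N_split.
have B0 : 0 < B by rewrite expn_gt0.
have m0 : 0 < m by rewrite expn_gt0.
have cS : #|{: {ffun 'I_m -> 'S_B}}| <= 2 ^ (b * N).
  rewrite card_ffun card_Sn card_ord; apply: leq_trans (_ : (B ^ B) ^ m <= _).
    by rewrite leq_exp2r // leq_fact_expn.
  by rewrite -expnM eN /B expn2M.
have BS : B.+1 <= 2 ^ b.+1 by rewrite expnS mul2n -addnn -[B.+1]addn1 leq_add2l.
have MW : (cells D * 2 ^ w).+1 <= 2 ^ (2 * w).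
  rewrite mul2n -addnn expnD; apply: leq_trans (_ : (cells D).+1 * 2 ^ w <= _).
    by rewrite mulSn -[X in X <= _]add1n leq_add2r expn_gt0.
  by rewrite leq_mul2r; apply/orP; right; lia.
have BMW : (B * cells D * 2 ^ w).+1 <= 2 ^ (3 * w).
  apply: leq_trans (_ : B * (cells D * 2 ^ w).+1 <= _).
    by rewrite mulnS -mulnA -[X in X <= _]add1n leq_add2r.
  have -> : 3 * w = w + 2 * w by lia.
  by rewrite expnD; apply: leq_mul => //; rewrite /B leq_pexp2l.
have leB : B <= N by rewrite -eN leq_pmulr.
apply: (@leq_trans ((2 ^ (b * N)) ^ 2 * 2 ^ N * ((2 ^ b.+1) ^ (2 * n)) ^ 2 *
  (((2 ^ (3 * w)) ^ (2 * x)) ^ 2 * (2 ^ (2 * w)) ^ (2 * x)))).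
  have exp_mono (a c k : nat) : a <= c -> a ^ k <= c ^ k.
    by case: k => // k ac; rewrite leq_exp2r.
  have l1 : #|{: {ffun 'I_m -> 'S_B}}| ^ 2 * 2 ^ B <= (2 ^ (b * N)) ^ 2 * 2 ^ N.
    have leN : 2 ^ B <= 2 ^ N by rewrite leq_pexp2l.
    exact: leq_mul (exp_mono _ _ 2 cS) leN.
  have l2 : (B.+1 ^ cells D) ^ 2 <= ((2 ^ b.+1) ^ (2 * n)) ^ 2.
    apply: (exp_mono _ _ 2); apply: leq_trans (exp_mono _ _ _ BS) _.
    by rewrite leq_pexp2l ?expn_gt0.
  apply: leq_mul (leq_mul l1 l2) (leq_mul _ _); last exact: exp_mono.
  exact: exp_mono (exp_mono _ _ _ BMW).
rewrite !expn2M -!expnD leq_pexp2l //.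
have bNn : b * N <= b * n by rewrite leq_mul2l leq_Nn orbT.
have nbn : 2 * n <= b * n by rewrite leq_mul2r b1 orbT.
by have := leq_Nn; rewrite !mulnA; lia.
Qed.

(** By [Hb], [Hx] and [HV], advice and waste are a small fraction of [lam * N] bits, while [N / 4]
    keys carry at least [lam] bits each. *)
Lemma big_bound : 16 * (advice_bound D (2 ^ b) (2 ^ (e - (f + b))) x * 2 ^ V) ^ 2 <
  q ^ (N %/ 4).
Proof.
apply: (@leq_trans ((2 ^ lam) ^ (N %/ 4))); last first.
  by case: (N %/ 4) => // N4; rewrite leq_exp2r.
apply: (@leq_ltn_trans (2 ^ (4 + (11 * (b * n) + 16 * (w * x) + V) * 2))).
  rewrite expnD -expn2M expnD leq_mul2l /= leq_sqr leq_mul2r advice_leq orbT.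
  by [].
rewrite expn2M ltn_exp2l //.
have lN : lam * N = 4 * (lam * (N %/ 4)) by rewrite mulnCA N_quarter.
have lN0 : 0 < lam * N by rewrite muln_gt0 lam0 N_gt0.
have bNn : b * N <= b * n by rewrite leq_mul2l leq_Nn orbT.
have nbn : 2 * n <= b * n by rewrite leq_mul2r b1 orbT.
by move: HV Hb Hx; rewrite lN in lN0 *; lia.
Qed.

Lemma level_gain2 :
  2 * level (2 ^ (e - f)) (2 ^ f) + 2 ^ f * (x.+1 * Om) <=
  2 * level (2 ^ (e - (f + b))) (2 ^ (f + b)).
Proof.
have eN : 2 ^ b * 2 ^ (e - (f + b)) = 2 ^ (e - f) by rewrite -N_split.
have := @level_gain (2 ^ (e - (f + b))) (2 ^ b) (2 ^ f) x (2 * (N %/ 4)) (N %/ 4).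
rewrite eN -(expnD 2 f b) -(expnD 2 f (e - f)); apply.
- by rewrite expn_gt0.
- by rewrite subnKC //; lia.
- by lia.
- exact: small_bound.
exact: big_bound.
Qed.

End Levels.

(** The blocks of level [i] have length [2 ^ (e - scale K i)]. *)
Fixpoint scale (K i : nat) : nat :=
  if i is i'.+1 then scale K i' + K * 2 ^ scale K i' else 0.

(** If [Q] is the quantity at [i], the next one is [Q * 2 ^ (2 * (K * 2 ^ f))], and both factors are
    at most [2 ^ (Q %/ 2)]. So one level costs one exponential. *)
Lemma scale_growth K i : 36 <= K ->
  800 * (K * 4 ^ scale K i.+1) <= 2 ^ (800 * (K * 4 ^ scale K i)).
Proof.
move=> K36; set f := scale K i; set Q := 800 * (K * 4 ^ f).
have e4 a : 4 ^ a = 2 ^ a * 2 ^ a by rewrite -expnMn.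
have f0 : 0 < 2 ^ f by rewrite expn_gt0.
have bQ : 800 * (K * 2 ^ f) <= Q by rewrite /Q e4 !leq_mul2l leq_pmulr ?orbT.
have -> : 800 * (K * 4 ^ scale K i.+1) = Q * 2 ^ (2 * (K * 2 ^ f)).
  by rewrite /Q /= -/f expnD [4 ^ (K * _)]e4 -expnD addnn -mul2n !mulnA.
have QQ : Q <= 2 ^ (Q %/ 2).
  have : 36 <= Q %/ 2 by rewrite leq_divRL //; apply: leq_trans bQ; nia.
  have := divn_eq Q 2; have := ltn_pmod Q (isT : 0 < 2).
  move: (Q %/ 2) (Q %% 2) => y r r2 -> y36.
  have : 2 * y + 2 <= 2 ^ y; last by lia.
  elim: y y36 => // y IH; rewrite leq_eqVlt => /predU1P[<- //|/IH].
  by rewrite expnS; lia.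
apply: leq_trans (leq_mul QQ (leqnn _)) _; rewrite -expnD leq_pexp2l //.
have := divn_eq Q 2; lia.
Qed.

Section Chain.
Variables (U w : nat) (D : dict U w) (n : nat) (x0 : 'I_U).
Hypothesis D_correct : correct_dict D n.
Variables (q R e lam L : nat).
Hypotheses (n_gt0 : 0 < n) (qU : 3 * n * q <= U).
Hypothesis memory_bound : (2 ^ w) ^ cells D <= q ^ n * 2 ^ ((R + 5) * n).
Hypotheses (en : 2 ^ e <= n) (ne : n < 2 ^ e.+1) (nw : 2 * n < 2 ^ w)
  (Mn : cells D <= 2 * n) (qlam : 2 ^ lam <= q) (lame : lam <= e) (lamw : lam <= w).
(** For [HV] with [V = (R + 5) * n]: as [n < 2 * 2 ^ e], the waste needs [4 * (R + 5)], and the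
    remaining terms at most [10]. *)
Let K := 4 * (R + 9).
Hypothesis small_scale : forall i, i < L -> 800 * (K * 4 ^ scale K i) <= lam.

Local Notation Om := #|[set p : (2 * n).-tuple 'I_U | uniq p]|.

(** A node of size [N] gains [lam * N / (800 * w)] touched cells on average and a level has
    [2 ^ e / N] nodes, so every level gains the same amount. *)
Lemma chain i : i <= L -> scale K i <= e /\
  i * (lam * 2 ^ e * Om) <=
    800 * w * level D n x0 (2 ^ (e - scale K i)) (2 ^ scale K i).
Proof.
elim: i => [|i IH] iL; first by [].
have [fe le] := IH (ltnW iL); have Q := small_scale iL.
set f := scale K i in fe le Q *; pose b := K * 2 ^ f; pose N := 2 ^ (e - f).
have f0 : 0 < 2 ^ f by rewrite expn_gt0.
have K36 : 36 <= K by rewrite /K; lia.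
have e4 : 4 ^ f = 2 ^ f * 2 ^ f by rewrite -expnMn.
have Kb : K <= b by rewrite leq_pmulr.
have b2 : 800 * b <= lam.
  by apply: leq_trans Q; rewrite leq_mul2l e4 mulnA leq_pmulr.
have fb : f < b by apply: leq_trans (ltn_expl f (isT : 1 < 2)) _; rewrite leq_pmull //; lia.
have eN : 2 ^ f * N = 2 ^ e by rewrite /N -expnD subnKC.
have E0 : 0 < 2 ^ e by rewrite expn_gt0.
have n2E : n < 2 * 2 ^ e by rewrite -expnS.
have NE : N <= 2 ^ e by rewrite leq_pexp2l // leq_subr.
have lam0 : 0 < lam by lia.
have w0 : 0 < w by lia.
(* The largest value that [Hx] allows; the [x.+1] in the gain makes up for the rounding. *)
pose x := lam * N %/ (400 * w).
have q0 : 0 < q by apply: leq_trans qlam; rewrite expn_gt0.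
have HV : 2 * ((R + 5) * n + 3 * N + 2) <= b * N.
  have -> : b * N = K * 2 ^ e by rewrite /b -mulnA eN.
  by have := leq_mul (leqnn (R + 5)) (ltnW n2E); rewrite /K; lia.
have Hb : 400 * (b * n) <= lam * N.
  rewrite -(leq_pmul2l f0) mulnCA -(mulnCA lam) eN.
  apply: leq_trans (_ : 800 * (K * 4 ^ f) * 2 ^ e <= _); last by rewrite leq_mul2r Q orbT.
  rewrite e4 /b; move: (ltnW n2E); move: (2 ^ f) (2 ^ e) => F E /(leq_mul (leqnn (400 * (K * (F * F))))).
  by lia.
have Hx : 400 * (w * x) <= lam * N by rewrite mulnA mulnC leq_trunc_div.
have b1 : 1 < b by lia.
have fbe : f + b <= e by lia.
have bw : b <= w by lia.
have := level_gain2 x0 D_correct n_gt0 q0 qU memory_bound b1 fbe en bw nw Mn qlam lam0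
  HV Hb Hx.
have fS : scale K i.+1 = f + b by [].
rewrite fS => gain; split; first by [].
move: gain le; set A := level _ _ _ _ _; set A' := level _ _ _ _ _; set O := Om => gain le.
have xS : lam * N <= 400 * w * x.+1.
  by apply: ltnW; rewrite [X in _ < X]mulnC; apply: ltn_ceil; lia.
have : lam * 2 ^ e * O <= 400 * w * (2 ^ f * (x.+1 * O)).
  apply: leq_trans (_ : 2 ^ f * (400 * w * x.+1) * O <= _); last by lia.
  by rewrite leq_mul2r -eN mulnCA leq_mul2l xS !orbT.
have := leq_mul (leqnn (400 * w)) gain.
rewrite mulSn; move: (2 ^ f * (x.+1 * O)) (lam * 2 ^ e * O) le => G H; lia.
Qed.

Lemma total_cost_lower :
  L * (lam * 2 ^ e * Om) <=
    800 * w * \sum_(p : (2 * n).-tuple 'I_U | uniq p) total_cost D n p.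
Proof.
have [fe le] := chain (leqnn L); apply: leq_trans le _.
rewrite leq_mul2l; apply/orP; right; apply: leq_sum => p _.
apply: leq_span_cost; first by rewrite size_tuple.
by rewrite -expnD subnKC.
Qed.

End Chain.

(** * The linear bound from the initial insertions *)

Section Inserts.
Variables (U w : nat) (D : dict U w) (n : nat).
Hypothesis D_correct : correct_dict D n.

Lemma leq_costs_inserts m S s : ok D n m S -> uniq s -> {in s, forall x, x \notin S} ->
  #|S| + size s <= n -> size s <= costs D [seq Ins x | x <- s] m.
Proof.
elim: s m S => //= x s IH m S okm /andP[xs us] nS sz.
have xS : x \notin S by apply: nS; rewrite mem_head.
have Sn : #|S| < n by apply: leq_trans sz; rewrite addnS ltnS leq_addr.
rewrite -[(size s).+1]add1n; apply: leq_add; first exact: ins_probes okm xS Sn.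
apply: (IH _ (x |: S)) => //; first exact: ok_ins.
  move=> y ys; rewrite !inE negb_or nS ?andbT; last by rewrite inE ys orbT.
  by apply: contraNneq xs => <-.
by rewrite cardsU1 xS add1n addSnnS.
Qed.

Lemma leq_total_cost p : uniq p -> size p = 2 * n -> n <= total_cost D n p.
Proof.
move=> up sp; rewrite /total_cost costs_cat; apply: leq_trans (leq_addr _ _).
have st : #|[set x in take n p]| = n.
  rewrite cardsE (card_uniqP _) ?take_uniq // size_take sp; case: ifP => //; lia.
rewrite -{1}st cardE; apply: (@leq_costs_inserts _ set0).
- exact: D_correct.
- exact: enum_uniq.
- by move=> x _; rewrite inE.
by rewrite cards0 -cardE st.
Qed.

End Inserts.

(** * Logarithms *)

(** As [U <= 6 * (n * q)], dividing [U ^ n] by the factorial leaves at most [(24 * q) ^ n], and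
    [24 <= 2 ^ 5]. *)
Lemma leq_bin_expn U n q : 0 < q -> U < 3 * n * q.+1 ->
  'C(U, n) <= q ^ n * 2 ^ (5 * n).
Proof.
move=> q0 Uq; have U6 : U <= 6 * (n * q) by nia.
rewrite -(leq_pmul2r (fact_gt0 n)) bin_ffact.
have le_ffact k : U ^_ k <= U ^ k.
  by elim: k => // k IH; rewrite ffactnSr expnSr leq_mul // leq_subr.
apply: leq_trans (le_ffact n) _.
have mono (a c : nat) : a <= c -> a ^ n <= c ^ n.
  by case: (n) => // k ac; rewrite leq_exp2r.
apply: leq_trans (mono _ _ U6) _; rewrite !expnMn.
apply: leq_trans (_ : 6 ^ n * ((4 ^ n * n`!) * q ^ n) <= _).
  by rewrite leq_mul2l leq_mul2r expn_self_leq_fact !orbT.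
have h : 6 ^ n * 4 ^ n <= 2 ^ (5 * n) by rewrite -expnMn expnM; apply: mono.
have := leq_mul h (leqnn (q ^ n * n`!)).
by move: (6 ^ n) (4 ^ n) (2 ^ _) (q ^ n) n`! => *; lia.
Qed.

Lemma uniq_tuples_gt0 U n : 2 * n <= U ->
  0 < #|[set p : (2 * n).-tuple 'I_U | uniq p]|.
Proof.
move=> nU; have := nsumE (2 * n) (setT : {set 'I_U}) (fun=> 1).
rewrite nsum_const cardsT card_ord muln1 => e.
rewrite -sum1_card (eq_bigl (fun p : (2 * n).-tuple 'I_U =>
  uniq p && ([set x in p] \subset setT))); last by move=> p; rewrite inE subsetT andbT.
by rewrite -e ffact_gt0.
Qed.

Local Open Scope R_scope.

Lemma pow2_INR a : INR (2 ^ a)%N = Rpower 2 (INR a).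
Proof.
rewrite Rpower_pow; last lra.
elim: a => //= a IH; rewrite expnS mult_INR IH /=; lra.
Qed.

Lemma Rpower2_log2 x : 0 < x -> Rpower 2 (log2 x) = x.
Proof.
move=> x0; rewrite /Rpower /log2; have := ln_lt_2 => l2.
by rewrite (_ : ln x / ln 2 * ln 2 = ln x) ?exp_ln //; field; lra.
Qed.

Lemma Rpower2_le x y : x <= y -> Rpower 2 x <= Rpower 2 y.
Proof. by move=> ?; apply: Rle_Rpower; lra. Qed.

Lemma Rpower2_le_inv x y : Rpower 2 x <= Rpower 2 y -> x <= y.
Proof.
move=> h; apply: Rnot_lt_le => lt; have : Rpower 2 y < Rpower 2 x by apply: Rpower_lt; lra.
lra.
Qed.

Lemma Rpower2_gt0 x : 0 < Rpower 2 x.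
Proof. exact: exp_pos. Qed.

(** Taking out one factor [exp 1 > 2] compensates for [ln 2], of which only the lower bound [1 / 2]
    is used. *)
Lemma le_Rpower2 x : x <= Rpower 2 x.
Proof.
have [x0|x0] := Rle_lt_dec x 0; first by have := Rpower2_gt0 x; lra.
have := ln_lt_2 => l2; rewrite /Rpower.
have e1 : 1 + 1 < exp 1 by apply: exp_ineq1; apply: R1_neq_R0.
have -> : exp (x * ln 2) = exp 1 * exp (x * ln 2 - 1) by rewrite -exp_plus; congr exp; lra.
have : x * ln 2 <= exp (x * ln 2 - 1).
  have := exp_ineq1_le (x * ln 2 - 1); lra.
move: (exp (x * ln 2 - 1)) (exp 1) e1 => u v v2 hu.
have u0 : x / 2 <= u by nra.
by have := Rmult_le_pos (v - 2) u ltac:(lra) ltac:(lra); lra.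
Qed.

Lemma sqr_le_Rpower2 x : 0 <= x -> x * x / 16 <= Rpower 2 x.
Proof.
move=> x0; have := ln_lt_2 => l2; rewrite /Rpower.
have -> : exp (x * ln 2) = exp (x * ln 2 / 2) * exp (x * ln 2 / 2).
  by rewrite -exp_plus; congr exp; lra.
have : x / 4 <= exp (x * ln 2 / 2).
  have := exp_ineq1_le (x * ln 2 / 2); nra.
move: (exp _) => u hu; have := Rmult_le_compat (x / 4) u (x / 4) u; lra.
Qed.

Lemma log2_le x : 0 < x -> log2 x <= x.
Proof. by move=> x0; have := le_Rpower2 (log2 x); rewrite Rpower2_log2. Qed.

Lemma log2_le_mul c x : 0 < c -> 64 / (c * c) <= x -> log2 x <= c * x.
Proof.
move=> c0 xc; have cc : 0 < c * c by nra.
have c64 : 0 < 64 / (c * c) by apply: Rdiv_lt_0_compat; lra.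
have x0 : 0 < x by lra.
apply: Rnot_lt_le => lt; have l0 : 0 <= log2 x by nra.
have := sqr_le_Rpower2 l0; rewrite Rpower2_log2 // => sq.
have h : 64 <= x * (c * c).
  by have := Rmult_le_compat_r (c * c) _ _ (Rlt_le _ _ cc) xc; rewrite /Rdiv Rmult_assoc Rinv_l; lra.
have cx : 0 <= c * x by nra.
have := Rmult_le_0_lt_compat (c * x) (log2 x) (c * x) (log2 x) cx cx lt lt.
by have := Rmult_le_compat_l x _ _ (Rlt_le _ _ x0) h; lra.
Qed.

Lemma log_star_gt1 fuel x k : (k <= log_star_aux fuel x)%N ->
  forall i, (i < k)%N -> 1 < iter_log i x.
Proof.
elim: fuel x k => [|f IH] x k /=; first by rewrite leqn0 => /eqP->.
case: (Rle_dec x R1) => [p|x1] /=; first by rewrite leqn0 => /eqP->.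
case: k => // k; rewrite ltnS => /IH h; case=> [|i]; first by rewrite /iter_log /=; lra.
by rewrite ltnS => /h; rewrite /iter_log iterSr.
Qed.

Section IteratedLog.
Variables (k : nat) (x : R).
Hypothesis gt1 : forall i, (i < k)%N -> 1 < iter_log i x.

Lemma iter_logE i : (i < k)%N -> iter_log i x = Rpower 2 (iter_log i.+1 x).
Proof. by move=> /gt1 h; rewrite /iter_log /= Rpower2_log2 //; rewrite /iter_log in h; lra. Qed.

Lemma iter_log_mono i j : (i <= j <= k)%N -> iter_log j x <= iter_log i x.
Proof.
elim: j => [|j IH]; first by rewrite leqn0 => /andP[/eqP-> _]; apply: Rle_refl.
rewrite leq_eqVlt => /andP[/predU1P[-> _|ij jk]]; first exact: Rle_refl.
have h := IH (introT andP (conj ij (ltnW jk))).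
have := gt1 jk; have : log2 (iter_log j x) <= iter_log j x by apply: log2_le; have := gt1 jk; lra.
by rewrite /iter_log /= in h *; lra.
Qed.

(** Going back from [iter_log (k - 1) x], the values are at least [1, 2, 4, 16, 65536]; the sixth
    exponential absorbs the factor [3200], since [y * y / 16 >= 4096 * y] for [y >= 65536]. *)
Lemma scale_base r : (6 <= k)%N -> INR r <= iter_log k x + 1 ->
  INR (800 * (4 * (r + 9)))%N <= iter_log (k - 6) x.
Proof.
move=> k6 hR.
have s (i : nat) (u v : R) : (0 < i <= 6)%N -> u <= iter_log (k - i.-1) x ->
    Rpower 2 u <= iter_log (k - i) x.
  move=> /andP[i0 i6] h; rewrite iter_logE; last by lia.
  by rewrite (_ : (k - i).+1 = (k - i.-1)%N); [apply: Rpower2_le | lia].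
have p (a b : nat) : (2 ^ a)%N = b -> Rpower 2 (INR a) = INR b.
  by move=> <-; rewrite pow2_INR.
have h1 : INR 1 <= iter_log (k - 1) x by have := gt1 (i := (k - 1)%N); rewrite /=; move=> /(_ ltac:(lia)); lra.
have h2 : INR 2 <= iter_log (k - 2) x by rewrite -(p 1%N) //; apply: s.
have h3 : INR 4 <= iter_log (k - 3) x by rewrite -(p 2%N) //; apply: s.
have h4 : INR 16 <= iter_log (k - 4) x by rewrite -(p 4%N) //; apply: s.
have h5 : 65536 <= iter_log (k - 5) x.
  have e16 : Rpower 2 (INR 16) = 65536.
    by rewrite Rpower_pow; [simpl; lra | lra].
  by rewrite -e16; apply: s.
have hk : iter_log k x <= iter_log (k - 5) x by apply: iter_log_mono; lia.
rewrite [iter_log (k - 6) x]iter_logE; last by lia.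
rewrite (_ : (k - 6).+1 = (k - 5)%N); last by lia.
move: (iter_log (k - 5) x) h5 hk => y y5 hk.
have := @sqr_le_Rpower2 y; move=> /(_ ltac:(lra)).
rewrite mult_INR mult_INR plus_INR.
have -> : INR 800 = 800 by rewrite INR_IZR_INZ.
have -> : INR 4 = 4 by rewrite INR_IZR_INZ.
have -> : INR 9 = 9 by rewrite INR_IZR_INZ.
have := Rmult_le_compat_r y _ _ (ltac:(lra) : 0 <= y) y5.
move: (Rpower 2 y) => z; lra.
Qed.

Lemma scale_small r i : (i + 7 <= k)%N -> INR r <= iter_log k x + 1 ->
  INR (800 * (4 * (r + 9) * 4 ^ scale (4 * (r + 9)) i))%N <= iter_log (k - 6 - i) x.
Proof.
move=> ik hR; elim: i ik => [|i IH] ik.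
  have -> : scale (4 * (r + 9)) 0 = 0%N by [].
  rewrite expn0 muln1 subn0; apply: scale_base hR; lia.
have h := IH (ltac:(lia)).
rewrite iter_logE; last by lia.
rewrite (_ : (k - 6 - i.+1).+1 = (k - 6 - i)%N); last by lia.
apply: Rle_trans (Rpower2_le h); rewrite -pow2_INR; apply: le_INR.
by apply/leP; apply: scale_growth; lia.
Qed.

End IteratedLog.

(** * The theorem *)

Lemma memory_bound_nat U w M n r q l :
  (0 < q)%N -> (n <= U)%N -> (U < 3 * n * q.+1)%N -> l <= INR r ->
  INR (M * w)%N <= log2 (INR 'C(U, n)) + INR n * l ->
  ((2 ^ w) ^ M <= q ^ n * 2 ^ ((r + 5) * n))%N.
Proof.
move=> q0 nU Uq lr mem.
have C0 : 0 < INR 'C(U, n) by apply: (lt_INR 0); apply/ltP; rewrite bin_gt0.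
have : ((2 ^ w) ^ M <= 'C(U, n) * 2 ^ (r * n))%N.
  apply/leP/INR_le; rewrite -expnM mult_INR !pow2_INR -[X in _ <= X * _](Rpower2_log2 C0).
  rewrite -Rpower_plus; apply: Rpower2_le; rewrite mulnC mult_INR.
  rewrite mult_INR in mem; rewrite mult_INR.
  by have := Rmult_le_compat_l (INR n) _ _ (pos_INR n) lr; lra.
move=> h; apply: leq_trans h _; rewrite mulnDl addnC expnD mulnA leq_mul2r.
by rewrite leq_bin_expn ?orbT.
Qed.

Section Bounds.
Variables (U w : nat) (D : dict U w) (n : nat).
Hypotheses (D_correct : correct_dict D n) (n_gt0 : (0 < n)%N) (nU : (2 * n <= U)%N).

Local Notation Om := #|[set p : (2 * n).-tuple 'I_U | uniq p]|.
Local Notation total := (\sum_(p : (2 * n).-tuple 'I_U | uniq p) total_cost D n p)%N.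

Lemma expected_probes_lower (a b : nat) :
  (a * Om <= b * total)%N -> INR a <= INR b * expected_probes D n.
Proof.
move=> /leP/le_INR; rewrite !mult_INR -expected_probesE // => h.
have Om0 : 0 < INR Om by apply: (lt_INR 0); apply/ltP; exact: uniq_tuples_gt0.
by apply: (Rmult_le_reg_r (INR Om)) => //; rewrite Rmult_assoc.
Qed.

Lemma expected_probes_trivial : INR n <= expected_probes D n.
Proof.
have := @expected_probes_lower n 1; rewrite Rmult_1_l; apply.
rewrite mul1n mulnC -sum_nat_const.
rewrite (eq_bigl (fun p : (2 * n).-tuple 'I_U => uniq p)); last by move=> p; rewrite inE.
by apply: leq_sum => p up; apply: leq_total_cost => //; rewrite size_tuple.
Qed.

End Bounds.

Lemma univ_bounds alpha n : let U := INR (univ alpha n) in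
  U <= Rpower (INR n) (1 + alpha) < U + 1.
Proof.
rewrite /univ; set x := Rpower _ _; have x0 : 0 < x by apply: exp_pos.
have [h1 h2] := base_Int_part x.
have z0 : (0 <= Int_part x)%Z.
  by have : (-1 < Int_part x)%Z; [apply: lt_IZR; lra | lia].
by rewrite /= INR_IZR_INZ Z2Nat.id //; lra.
Qed.

Theorem theorem4 :
  forall alpha : R, Rlt R0 alpha ->
  exists c : R, Rlt R0 c /\
  exists N : nat, forall n : nat, (N <= n)%N ->
  forall k : nat, (1 <= k)%N -> (k <= log_star n)%N ->
  forall D : dict (univ alpha n) (wsize alpha n),
    correct_dict D n ->
    (* memory = log C(U,n) + R bits, with r = R/n <= log^{(k)} n *)
    Rle (INR (cells D * wsize alpha n))
        (Rplus (log2 (INR 'C(univ alpha n, n))) (Rmult (INR n) (iter_log k (INR n)))) ->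
    Rle (Rmult c (Rmult (INR n) (INR k))) (expected_probes D n).
Proof.
(* [rho] is a lower bound for [lam / w], as [lam >= a / 2 * y] and [w <= (2 + alpha) * y] for
   [y = log2 n]; [a] is capped at [1] because [lam] is at most [e]. *)
move=> alpha alpha0; pose a := Rmin alpha 1; pose rho := a / (2 * (2 + alpha)).
have a0 : 0 < a by apply: Rmin_glb_lt; lra.
have a_alpha : a <= alpha by apply: Rmin_l.
have a1 : a <= 1 by apply: Rmin_r.
have rho0 : 0 < rho by apply: Rdiv_lt_0_compat; lra.
have rhoE : rho * (2 * (2 + alpha)) = a by rewrite /rho; field; lra.
have rho1 : rho <= 1 by nra.
(* The terms ensure [log2 y <= a / 2 * y], then [6 <= a * y] against the rounding of [lam], then
   [4 <= y]. *)
pose Y := 64 / (a / 2 * (a / 2)) + 6 / a + 4.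
have Y1 : 0 < 64 / (a / 2 * (a / 2)) by apply: Rdiv_lt_0_compat; nra.
have Y2 : 0 < 6 / a by apply: Rdiv_lt_0_compat; lra.
(* [3200] is the [800] of the chain, doubled for [L >= k / 2] and again for [2 ^ e >= n / 2]. *)
exists (rho / 3200); split; first by apply: Rdiv_lt_0_compat; lra.
exists (Z.to_nat (up (Rpower 2 Y))) => n Nn k k1 klog D Dc mem.
set U := univ alpha n in D Dc mem *; set w := wsize alpha n in D Dc mem *.
have nY : Rpower 2 Y <= INR n.
  have := archimed (Rpower 2 Y) => -[up1 _]; have := Rpower2_gt0 Y => P0.
  have : INR (Z.to_nat (up (Rpower 2 Y))) <= INR n by apply: le_INR; apply/leP.
  rewrite INR_IZR_INZ Z2Nat.id; first lra.
  by apply: le_IZR; lra.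
have n0R : 0 < INR n by have := Rpower2_gt0 Y; lra.
have n0 : (0 < n)%N by apply/ltP; apply: INR_lt.
pose y := log2 (INR n).
have ny : INR n = Rpower 2 y by rewrite Rpower2_log2.
have yY : Y <= y by apply: Rpower2_le_inv; rewrite -ny.
have y4 : 4 <= y by rewrite /Y in yY; lra.
have ay6 : 6 <= a * y.
  have : a * (6 / a) = 6 by field; lra.
  by rewrite /Y in yY; have := Rmult_le_compat_l a (6 / a) y; lra.
have UB : INR U <= Rpower 2 ((1 + alpha) * y) < INR U + 1.
  by have := univ_bounds alpha n; rewrite /= -/U ny Rpower_mult (Rmult_comm y).
have nUa : Rpower 2 ((1 + alpha) * y) = INR n * Rpower 2 (alpha * y).
  by rewrite ny -Rpower_plus; congr Rpower; lra.
have alpha6 : 64 <= Rpower 2 (alpha * y).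
  have e64 : Rpower 2 (INR 6) = 64 by rewrite Rpower_pow; [simpl; lra | lra].
  by rewrite -e64; apply: Rpower2_le; rewrite (INR_IZR_INZ 6) /=; nra.
have n1R : 1 <= INR n by apply: (le_INR 1); apply/leP.
have nU3 : (3 * n <= U)%N.
  apply/leP/INR_le; rewrite mult_INR (INR_IZR_INZ 3) /=.
  by have := Rmult_le_compat_l (INR n) _ _ (Rlt_le _ _ n0R) alpha6; lra.
pose q := (U %/ (3 * n))%N.
have q0 : (0 < q)%N by rewrite divn_gt0 //; lia.
have qU : (3 * n * q <= U)%N by rewrite mulnC leq_trunc_div.
have Uq : (U < 3 * n * q.+1)%N by rewrite mulnC ltn_ceil //; lia.
have nU : (2 * n <= U)%N by lia.
(* For small [k] the bound of [n] probes suffices; from [14] on, [k - 7] is at least [k / 2]. *)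
have k14_or : (k < 14)%N \/ (14 <= k)%N by lia.
have E0 := expected_probes_trivial Dc nU.
case: k14_or => k14.
  have k14R : INR k <= 14 by have : INR k <= INR 14 by [apply: le_INR; lia]; rewrite (INR_IZR_INZ 14).
  have : rho / 3200 * (INR n * INR k) <= 1 / 3200 * (INR n * 14).
    apply: Rmult_le_compat; [lra | by apply: Rmult_le_pos; [lra | apply: pos_INR] | lra |].
    by apply: Rmult_le_compat_l; lra.
  lra.
have gt1 := log_star_gt1 klog.
pose l := iter_log k (INR n); pose r := Z.to_nat (up l).
have l0 : 0 < l.
  have h := @gt1 k.-1 ltac:(lia).
  have -> : l = log2 (iter_log k.-1 (INR n)) by rewrite /l -{1}(prednK k1).
  apply: Rdiv_lt_0_compat; last by have := ln_lt_2; lra.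
  by have := ln_increasing 1 _ Rlt_0_1 h; rewrite ln_1.
have [rl lr] : INR r <= l + 1 /\ l <= INR r.
  have [u1 u2] := archimed l.
  rewrite /r INR_IZR_INZ Z2Nat.id; first lra.
  by apply: le_IZR; lra.
have memN := memory_bound_nat q0 (ltac:(lia) : (n <= U)%N) Uq lr mem.
pose e := trunc_log 2 n; pose t := trunc_log 2 q; pose lam := minn e t.
have /andP[en ne] := trunc_log_bounds (isT : (1 < 2)%N) n0.
have /andP[tq qt] := trunc_log_bounds (isT : (1 < 2)%N) q0.
rewrite -/e -/t in en ne tq qt.
have qlam : (2 ^ lam <= q)%N by apply: leq_trans tq; rewrite leq_pexp2l // geq_minr.
have U1 : (1 < U)%N by lia.
have /andP[wU Uw] := up_log_bounds (isT : (1 < 2)%N) U1.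
rewrite -[up_log 2 U]/w in wU Uw.
have lame : (lam <= e)%N by rewrite geq_minl.
have lamw : (lam <= w)%N.
  rewrite -(leq_exp2l _ _ (isT : (1 < 2)%N)); apply: leq_trans qlam (leq_trans _ Uw).
  by apply: leq_trans qU; rewrite leq_pmull //; lia.
have nw : (2 * n < 2 ^ w)%N by lia.
have INRS m : INR m.+1 = INR m + 1 by rewrite S_INR.
have e_low : y - 1 <= INR e.
  have : Rpower 2 y <= Rpower 2 (INR e.+1).
    by rewrite -ny -pow2_INR; apply: le_INR; apply/leP/ltnW.
  by move/Rpower2_le_inv; rewrite INRS; lra.
have t_low : alpha * y - 3 <= INR t.
  have : Rpower 2 (alpha * y) <= Rpower 2 (INR t.+3).
    rewrite -pow2_INR; apply: (Rmult_le_reg_l (INR n)) => //; rewrite -nUa.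
    apply: Rle_trans (_ : INR U + 1 <= _); first lra.
    rewrite -S_INR -mult_INR multE; apply: le_INR; apply/leP; apply: leq_trans Uq _.
    rewrite (mulnC 3%N) -mulnA leq_mul2l; apply/orP; right.
    by rewrite !expnS; move: qt; rewrite expnS; lia.
  by move/Rpower2_le_inv; rewrite !INRS; lra.
have lam_low : a / 2 * y <= INR lam.
  have ay : a * y <= alpha * y by apply: Rmult_le_compat_r; lra.
  have ay' : a * y <= y by have := Rmult_le_compat_r y _ _ (ltac:(lra) : 0 <= y) a1; lra.
  by rewrite /lam /minn; case: ifP => _; lra.
have w_up : INR w <= (2 + alpha) * y.
  have w1 : (0 < w)%N by rewrite up_log_gt0.
  have : Rpower 2 (INR w.-1) <= Rpower 2 ((1 + alpha) * y).
    rewrite -pow2_INR; apply: Rle_trans (proj1 UB); apply: le_INR; apply/leP/ltnW.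
    exact: wU.
  have -> : INR w = INR w.-1 + 1 by rewrite -INRS prednK.
  by move/Rpower2_le_inv; lra.
have lam_w : rho * INR w <= INR lam.
  have := Rmult_le_compat_l rho _ _ (Rlt_le _ _ rho0) w_up.
  have -> : rho * ((2 + alpha) * y) = a / 2 * y by rewrite -rhoE; lra.
  by lra.
(* Six logarithms pay for the constants; for [i < L] at least two remain, and [log2 (log2 n)] is
   below [lam]. *)
pose L := (k - 7)%N.
have small i : (i < L)%N -> (800 * (4 * (r + 9) * 4 ^ scale (4 * (r + 9)) i) <= lam)%N.
  move=> iL; apply/leP/INR_le.
  have h := scale_small gt1 (i := i) (ltac:(lia) : (i + 7 <= k)%N) rl.
  have h2 : iter_log (k - 6 - i) (INR n) <= iter_log 2 (INR n).
    by apply: (iter_log_mono gt1); lia.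
  have : iter_log 2 (INR n) <= a / 2 * y.
    by apply: log2_le_mul; rewrite -/y; [lra | rewrite /Y in yY; lra].
  lra.
(* Both [q] and [2 ^ (r + 5)] are at most [2 ^ w], so the memory bound is at most
   [2 ^ (2 * w * n)]. *)
have Mn : (cells D <= 2 * n)%N.
  have r5 : (r + 5 <= w)%N.
    have := small 0%N ltac:(lia).
    have -> : scale (4 * (r + 9)) 0 = 0%N by [].
    by rewrite expn0; lia.
  have q2w : (q <= 2 ^ w)%N by apply: leq_trans Uw; apply: leq_trans qU; rewrite leq_pmull //; lia.
  have : ((2 ^ w) ^ cells D <= (2 ^ w) ^ n * 2 ^ (w * n))%N.
    apply: leq_trans memN _; apply: leq_mul; first by rewrite leq_exp2r.
    by rewrite leq_pexp2l // leq_mul2r r5 orbT.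
  rewrite -!expnM -expnD leq_exp2l // -mulnDr leq_pmul2l; first by lia.
  by rewrite up_log_gt0.
have x0 : 'I_U by exists 0%N; lia.
have main := total_cost_lower x0 Dc n0 qU memN en ne nw Mn qlam lame lamw small.
have {}main := expected_probes_lower nU (leq_trans (eq_leq (esym (mulnA _ _ _))) main).
rewrite !mult_INR (INR_IZR_INZ 800) /= in main.
have Lk : INR k / 2 <= INR L.
  have : INR k = INR L + 7 by rewrite /L minus_INR; [simpl; lra | lia].
  have : INR 14 <= INR k by apply: le_INR; lia.
  by rewrite (INR_IZR_INZ 14) /=; lra.
have En : INR n / 2 <= INR (2 ^ e)%N.
  have : INR n <= INR (2 * 2 ^ e)%N by apply: le_INR; apply/leP; rewrite -expnS ltnW.
  by rewrite mult_INR /=; lra.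
have w0R : 0 < INR w by apply: (lt_INR 0); apply/ltP; rewrite up_log_gt0.
apply: (Rmult_le_reg_l (800 * INR w)); first lra.
apply: Rle_trans main; have kR := pos_INR k.
have h1 : INR k / 2 * (INR n / 2) <= INR L * INR (2 ^ e)%N by apply: Rmult_le_compat; lra.
have h2 := Rmult_le_compat _ _ _ _ (ltac:(nra) : 0 <= rho * INR w)
  (ltac:(nra) : 0 <= INR k / 2 * (INR n / 2)) lam_w h1.
by lra.
Qed.
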